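(* Let $n\ge 1$. There are positive constants $\tilde k_l,\tilde k_u>0$ and $\tilde t_0$ such that for all $t\ge \tilde t_0$ $$ n-\frac{\tilde k_l}{t\, e^{\frac{1}{2n}t}}\ \le\ \dim\Big(\big\{\bar x\in\mathbb R^n:\ g_s\Lambda_{\bar x}\notin \mathcal L_{n+1}(e^{-t/(n+1)})\ \text{for all } s\ge 0\big\}\Big)\ \le\ n-\frac{\tilde k_u}{t\, e^{(n+1)t}} . $$
   Context: $\dim$ denotes Hausdorff dimension. $\mathcal L_{n+1}$ is the space of unimodular lattices in $\mathbb R^{n+1}$, i.e. of lattices $\Lambda=g\mathbb Z^{n+1}$ with $g\in SL_{n+1}(\mathbb R)$. Put $\Delta(\Lambda)=\min\{\|w\|: w\in\Lambda, w\ne 0\}$, with $\|\cdot\|$ the supremum norm, and for $\varepsilon>0$ let $\mathcal L_{n+1}(\varepsilon)=\{\Lambda\in\mathcal L_{n+1}:\Delta(\Lambda)\le\varepsilon\}$. For $s\ge 0$ let $g_s=\mathrm{diag}(e^{s},\dots,e^{s},e^{-ns})$ ($n$ entries $e^s$), acting on $\mathcal L_{n+1}$ by left multiplication. For $\bar x\in\mathbb R^n$ let $$\Lambda_{\bar x}=\begin{pmatrix} I_{n\times n}&\bar x\\0&1\end{pmatrix}\mathbb Z^{n+1}=\{(q\bar x-\bar p,\,q):(\bar p,q)\in\mathbb Z^n\times\mathbb Z\}.$$ *)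

(* Defs.v *)
From mathcomp Require Import all_boot all_order all_algebra.
From mathcomp Require Import all_classical all_reals all_analysis.

Set Implicit Arguments.
Unset Strict Implicit.
Unset Printing Implicit Defensive.

Import Order.TTheory GRing.Theory Num.Theory.
Import numFieldNormedType.Exports.

Local Open Scope classical_set_scope.
Local Open Scope ring_scope.

Section Hausdorff.
Context {R : realType} {V : normedModType R}.

(* The element 0 only matters for U = set0, where the supremum of the distances
   would otherwise be -oo. *)
Definition diam (U : set V) : \bar R :=
  ereal_sup (0%E |` [set `|x - y|%:E | x in U & y in U]).

(* Since 0 `^ 0 = 1, the empty set has to be treated apart when s = 0. *)
Definition diam_pow (s : R) (U : set V) : \bar R :=
  if U == set0 then 0%E else (diam U `^ s)%E.

Definition hausdorff_content (s delta : R) (A : set V) : \bar R :=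
  ereal_inf [set (\sum_(0 <= i <oo) diam_pow s (U i))%E | U in
    [set U : (set V)^nat | A `<=` \bigcup_i U i /\
                           forall i, (diam (U i) <= delta%:E)%E]].

(* The content is nonincreasing in delta, so the supremum is the limit as
   delta tends to 0. *)
Definition hausdorff_measure (s : R) (A : set V) : \bar R :=
  ereal_sup [set hausdorff_content s delta A | delta in [set d : R | 0 < d]].

Definition hausdorff_dim (A : set V) : \bar R :=
  ereal_inf [set s%:E | s in [set s : R | 0 <= s /\
                                          hausdorff_measure s A = 0%E]].

End Hausdorff.

Section Lattices.
Context {R : realType}.

Definition lattice_of m (g : 'M[R]_m) : set 'cV[R]_m :=
  [set g *m map_mx intr z | z in [set: 'cV[int]_m]].

Definition unimodular_lattice m : set (set 'cV[R]_m) :=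
  [set lattice_of g | g in [set g : 'M[R]_m | \det g = 1]].

(* The norm of 'cV[R]_m is the supremum norm. For a lattice, which is discrete,
   this infimum is a minimum. *)
Definition shortest m (L : set 'cV[R]_m) : R :=
  inf [set `|w| | w in [set w | L w /\ w <> 0]].

Definition short_lattice m (eps : R) : set (set 'cV[R]_m) :=
  [set L | unimodular_lattice L /\ shortest L <= eps].

Definition lattice_act m (g : 'M[R]_m) (L : set 'cV[R]_m) : set 'cV[R]_m :=
  [set g *m w | w in L].

Definition flow n (s : R) : 'M[R]_(n + 1) :=
  block_mx (expR s)%:M 0 0 (expR (- (n%:R * s)))%:M.

Definition lattice_at n (x : 'cV[R]_n) : set 'cV[R]_(n + 1) :=
  lattice_of (block_mx 1%:M x 0 1%:M).

End Lattices.

(* Main.v *)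
Require Import Defs.
From mathcomp Require Import all_boot all_order all_algebra.
From mathcomp Require Import all_classical all_reals all_analysis.
From mathcomp Require Import zify ring lra.
Import Order.TTheory GRing.Theory Num.Theory.
Import numFieldNormedType.Exports.
Local Open Scope classical_set_scope.
Local Open Scope ring_scope.
Set Implicit Arguments.
Unset Strict Implicit.
Unset Printing Implicit Defensive.

(* With c = e^{-t} = eps^{n+1}, minimising over s the norm of the vector of
   g_s Lambda_x attached to (p, q) shows that the orbit of x stays outside the
   cusp exactly when q |qx - p|^n > c for all p and all q >= 1, up to constants
   and strictness.

   Upper bound: a cube of side r containing a badly approximable x near its
   centre contains, by Dirichlet's theorem, a rational p/q near x whose
   denominator satisfies q <= C (e^t / r)^{n/(n+1)}; no point of the ball of
   radius (c / q^{n+1})^{1/n} around p/q is badly approximable, and that ball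
   contains one of the N^n subcubes of side r/N as soon as N is of order
   e^{t(n+1)/n}. Hence (N^n - 1)^k cubes of side N^{-k} suffice at level k.

   Lower bound: by Dirichlet's theorem for one linear form, the rationals in a
   cube of side r = N^{-k} with q^{n+1} smaller than a constant times r^{-n}
   lie on one hyperplane. Discarding the subcubes of side r/N near it leaves
   N^n - O(N^{n-1}) children, and the remaining points avoid every rational if
   N is of order e^{t/(2n)}. A cover of small s-dimensional cost is then avoided
   together with the rationals by a greedy choice of children. *)

(** * Dirichlet's theorem by pigeonhole *)

Lemma cV_norm_le (R : realType) n (x : 'cV[R]_n) (r : R) : 0 <= r ->
  (forall j, `|x j 0| <= r) -> `|x| <= r.
Proof.
move=> r0 xr; rewrite [leLHS]/Num.Def.normr /= mx_normrE.
by apply: (bigmax_le _ r0) => -[i j] _ /=; rewrite ord1.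
Qed.

Lemma cV_norm_lt (R : realType) n (x : 'cV[R]_n) (r : R) : 0 < r ->
  (forall j, `|x j 0| < r) -> `|x| < r.
Proof.
move=> r0 xr; rewrite [ltLHS]/Num.Def.normr /= mx_normrE.
by apply: (bigmax_lt _ r0) => -[i j] _ /=; rewrite ord1.
Qed.

Lemma le_cV_norm (R : realType) n (x : 'cV[R]_n) j : `|x j 0| <= `|x|.
Proof.
rewrite [leRHS]/Num.Def.normr /= mx_normrE.
exact: (le_bigmax _ (fun ij : 'I_n * 'I_1 => `|x ij.1 ij.2|) (j, 0)).
Qed.

(** Pigeonhole on the A^m boxes of side 1/A of the unit cube: two indices whose fractional parts
    fall into the same box differ, modulo integers, by less than 1/A in every coordinate. *)
Lemma dirichlet_box (R : realType) (T : finType) (m A : nat)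
    (f : T -> 'I_m -> R) : (0 < A)%N -> (A ^ m < #|T|)%N ->
  exists t1 t2, t1 != t2 /\
    forall j, exists p : int, `|f t1 j - f t2 j - p%:~R| < A%:R^-1.
Proof.
move=> A0 cT.
have AR : 0 < A%:R :> R by rewrite ltr0n.
pose fr (y : R) := y - (Num.floor y)%:~R.
have fr0 y : 0 <= fr y by rewrite subr_ge0 floor_le.
have fr1 y : fr y < 1.
  by rewrite ltrBlDr addrC; have := floorD1_gt y; rewrite intrD.
have tr y : (Num.truncn (A%:R * fr y) < A)%N.
  rewrite truncn_lt_nat; first by rewrite -[ltRHS]mulr1 ltr_pM2l.
  by rewrite mulr_ge0 // ltW.
pose g t := [ffun j => Ordinal (tr (f t j))].
have : ~~ injectiveb g.
  apply/negP => /injectiveP /leq_card.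
  by rewrite card_ffun !card_ord leqNgt cT.
move=> /injectivePn [t1 [t2 t12 g12]]; exists t1, t2; split=> // j.
exists (Num.floor (f t1 j) - Num.floor (f t2 j)).
have := congr1 (fun h : {ffun 'I_m -> 'I_A} => nat_of_ord (h j)) g12.
rewrite !ffunE /= => e.
have /truncn_itv/andP[l1 u1] : 0 <= A%:R * fr (f t1 j)
  by rewrite mulr_ge0 // ltW.
have /truncn_itv/andP[l2 u2] : 0 <= A%:R * fr (f t2 j)
  by rewrite mulr_ge0 // ltW.
rewrite e in l1 u1.
have -> : f t1 j - f t2 j - (Num.floor (f t1 j) - Num.floor (f t2 j))%:~R =
  fr (f t1 j) - fr (f t2 j) by rewrite /fr intrB; ring.
rewrite -(ltr_pM2l AR) mulfV ?gt_eqF // -{1}(gtr0_norm AR) -normrM mulrBr.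
move: u1 u2; rewrite -natr1 => u1 u2.
by rewrite ltr_norml; apply/andP; split; lra.
Qed.

(** The pigeons are the multiples q x with 0 <= q <= A^n; the difference of two of them is again
    such a multiple. *)
Lemma dirichlet_simultaneous (R : realType) n (x : 'cV[R]_n) (A : nat) :
  (0 < A)%N -> exists (q : nat) (p : 'cV[int]_n),
    [/\ (0 < q)%N, (q <= A ^ n)%N & `|q%:R *: x - map_mx intr p| < A%:R^-1].
Proof.
move=> A0.
have [|t1 [t2 [t12 /choice[p Hp]]]] := @dirichlet_box R 'I_(A ^ n).+1 n A
  (fun q j => (q : nat)%:R * x j 0) A0; first by rewrite card_ord.
wlog lt12 : t1 t2 t12 p Hp / (t2 < t1)%N.
  move=> W; have [lt|lt|e] := ltngtP t2 t1; first exact: (W t1 t2 t12 p).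
    apply: (W t2 t1 _ (fun j => - p j)) => //; first by rewrite eq_sym.
    move=> j; rewrite intrN -normrN; have := Hp j.
    by congr (`| _ | < _); ring.
  by move: t12; rewrite (val_inj e) eqxx.
exists (t1 - t2)%N, (\col_j p j); split; first by rewrite subn_gt0.
  by rewrite (leq_trans (leq_subr _ _)) // -ltnS.
apply: cV_norm_lt; first by rewrite invr_gt0 ltr0n.
move=> j; rewrite !mxE natrB ?(ltnW lt12) // mulrBl; exact: Hp.
Qed.

(** The pigeons are the (A+1)^n forms with coefficients in {0, ..., A}, and the boxes are A^n
    intervals of the circle. *)
Lemma dirichlet_linear_form (R : realType) n (x : 'I_n -> R) (A : nat) :
  (0 < n)%N -> (0 < A)%N -> exists (a : 'I_n -> int) (b : int),
    [/\ exists j, a j != 0, forall j, `|(a j)%:~R : R| <= A%:R &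
        `|\sum_j (a j)%:~R * x j + b%:~R| < (A%:R ^+ n)^-1].
Proof.
move=> n0 A0.
have [||t1 [t2 [t12 /(_ ord0)[p Hp]]]] :=
  @dirichlet_box R {ffun 'I_n -> 'I_A.+1} 1 (A ^ n)
  (fun a _ => \sum_j (a j : nat)%:R * x j); first by rewrite expn_gt0 A0.
  by rewrite card_ffun !card_ord expn1 ltn_exp2r.
exists (fun j => (t1 j : nat)%:Z - (t2 j : nat)%:Z), (- p); split.
- apply: contrapT => H; move/eqP: t12; apply; apply/ffunP => j.
  apply/val_inj/eqP; rewrite -eqz_nat -subr_eq0.
  by apply/negPn/negP => Hj; apply: H; exists j.
- move=> j; rewrite intrB /= ler_norml.
  have := ltn_ord (t1 j); have := ltn_ord (t2 j).
  rewrite !ltnS -!(ler_nat R) => h2 h1.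
  have := ler0n R (t1 j); have := ler0n R (t2 j) => ? ?.
  by apply/andP; split; rewrite -?pmulrn; lra.
- rewrite natrX in Hp; apply: le_lt_trans Hp; rewrite le_eqVlt; apply/orP; left.
  apply/eqP; congr (`| _ |); rewrite intrN; congr (_ - _).
  by rewrite -sumrB; apply: eq_bigr => j _; rewrite intrB mulrBl -!pmulrn.
Qed.

(** * Children of a cube that avoid rationals *)

(* Forgetting d j0 except for its residue modulo 2C + 1 is injective on the
   slab. *)
Lemma slab_count (m B C : nat) (a : 'I_m.+1 -> int) (b : int) (j0 : 'I_m.+1) :
  a j0 != 0 ->
  (#|[set d : {ffun 'I_m.+1 -> 'I_B} |
      (`|\sum_j a j * (d j : nat)%:Z + b| <= C%:Z * `|a j0|)%R]%SET|
   <= B ^ m * (2 * C).+1)%N.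
Proof.
move=> aj0; set S := [set d | _]%SET.
pose f (d : {ffun 'I_m.+1 -> 'I_B}) : {ffun 'I_m -> 'I_B} * 'I_(2 * C).+1 :=
  ([ffun i => d (lift j0 i)], inord (d j0 %% (2 * C).+1)).
have finj : {in S &, injective f}.
  move=> d d'; rewrite !inE => hd hd' [/ffunP e1 e2].
  have {}e1 i : d (lift j0 i) = d' (lift j0 i) by have := e1 i; rewrite !ffunE.
  have {}e2 : (d j0 = d' j0 %[mod (2 * C).+1])%N.
    by have := congr1 val e2; rewrite /= !inordK ?ltn_pmod.
  have e : d j0 = d' j0.
    apply: val_inj => /=; move: hd hd'; rewrite !(bigD1_ord j0) //=.
    have -> : \sum_i a (lift j0 i) * (d (lift j0 i) : nat)%:Z =
              \sum_i a (lift j0 i) * (d' (lift j0 i) : nat)%:Z.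
      by apply: eq_bigr => i _; rewrite e1.
    set r := \sum_i _; move: e2.
    set y := nat_of_ord (d j0); set y' := nat_of_ord (d' j0) => e2 h1 h2.
    (* With the other digits fixed, two points of the slab have digits at [j0] at most 2C apart, so
       congruence modulo 2C + 1 forces equality. *)
    have : `|a j0| * `|y%:Z - y'%:Z| <= `|a j0| * (2 * C%:Z).
      rewrite -normrM.
      have -> : a j0 * (y%:Z - y'%:Z) =
          (a j0 * y + r + b) - (a j0 * y' + r + b).
        by ring.
      by apply: le_trans (ler_normB _ _) _; lia.
    rewrite ler_pM2l ?normr_gt0 // => h.
    clear h1 h2; wlog le : y y' e2 h / (y' <= y)%N.
      move=> W; have [|lt] := leqP y' y; first exact: W.
      by rewrite (W y' y) ?(ltnW lt) // distrC.
    move/eqP: e2; rewrite eqn_mod_dvd // => dv.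
    have [/eqP|gt0] := posnP (y - y')%N.
      by rewrite subn_eq0 => le'; apply/eqP; rewrite eqn_leq le le'.
    by have := dvdn_leq gt0 dv; lia.
  apply/ffunP => j; case: (unliftP j0 j) => [i ->|->]; [exact: e1|exact: e].
rewrite -(card_in_imset finj); apply: leq_trans (max_card _) _.
by rewrite card_prod card_ffun !card_ord.
Qed.

(* The half-open N-adic cube of level k with corner v / N^k. *)
Definition in_cube (R : realType) n (N k : nat) (v : 'I_n -> int)
    (x : 'cV[R]_n) : bool :=
  [forall j, (v j)%:~R <= N%:R ^+ k * x j 0 < (v j)%:~R + 1].

(* With B = N - 1 the last digit is excluded, so that the limit of the corners
   of nested children lies in all the half-open cubes. *)
Definition child n (N B : nat) (v : 'I_n -> int) (d : {ffun 'I_n -> 'I_B}) :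
    'I_n -> int :=
  fun j => N%:Z * v j + (d j : nat)%:Z.

Lemma in_cube_child (R : realType) n (N B k : nat) (v : 'I_n -> int)
    (d : {ffun 'I_n -> 'I_B}) (x : 'cV[R]_n) : (B <= N)%N ->
  in_cube N k.+1 (child N v d) x -> in_cube N k v x.
Proof.
move=> BN /forallP H; apply/forallP => j; have /andP := H j.
rewrite /child intrD intrM -!pmulrn exprS -mulrA.
have dB : (d j : nat)%:R + 1 <= N%:R :> R.
  by rewrite natr1 ler_nat (leq_trans (ltn_ord _)).
have N0 : 0 < N%:R :> R by have := ler0n R (d j); lra.
move=> [l u]; apply/andP; split.
  by rewrite -(ler_pM2l N0); have := ler0n R (d j); lra.
by rewrite -(ltr_pM2l N0) mulrDr mulr1; lra.
Qed.

(* If denominator_scale n * q^{n+1} <= r^{-n} and A is the integer part of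
   r^{-1/(n+1)}, then (2n + 1) q < A^n. *)
Definition denominator_scale n : nat := ((2 * n + 1) * 2 ^ n) ^ n.+1.

Lemma norm_linear_form_le (R : realType) n (a : 'I_n -> int) (w : 'I_n -> R)
    (alpha beta : R) :
  (forall j, `|(a j)%:~R| <= alpha) -> (forall j, `|w j| <= beta) ->
  `|\sum_j (a j)%:~R * w j| <= n%:R * (alpha * beta).
Proof.
move=> ha hw; apply: le_trans (ler_norm_sum _ _ _) _.
rewrite -[n in n%:R]card_ord mulr_natl -sumr_const; apply: ler_sum => j _.
by rewrite normrM ler_pM.
Qed.

(** The last inequality says |x - p/q| > N^{-(k+1)}, the side of a child. The form a.X + b that
    Dirichlet's theorem gives at the corner of the cube vanishes at every rational violating it, so
    the children to discard lie in a slab around one hyperplane. [slab_count] with C = 2n removes at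
    most 4n + 1 times B^(n-1) of the B^n children; the remaining unit in 4n + 2 is N - B. *)
Lemma rational_free_children (R : realType) (m B k : nat)
    (v : 'I_m.+1 -> int) :
  exists G : {set {ffun 'I_m.+1 -> 'I_B}},
    ((B.+1 - (4 * m.+1 + 2)) ^ m.+1 <= #|G|)%N /\
    forall d (x : 'cV[R]_m.+1), d \in G ->
      in_cube B.+1 k.+1 (child B.+1 v d) x ->
      forall (p : 'cV[int]_m.+1) (q : nat), (0 < q)%N ->
        (denominator_scale m.+1 * q ^ m.+2 <= B.+1 ^ (k * m.+1))%N ->
        q%:R < B.+1%:R ^+ k.+1 * `|q%:R *: x - map_mx intr p|.
Proof.
set n := m.+1; set N := B.+1.
have N0 : 0 < N%:R :> R by rewrite ltr0n.
(* A is the integer part of N^{k/(n+1)}. It balances the value A^{-n} of the form at the corner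
   against its variation, of order A/N^k, across the cube. *)
have [A A0 /andP[A1 A2]] :
    exists2 A, (0 < A)%N & (A ^ n.+1 <= N ^ k < A.+1 ^ n.+1)%N.
  have ex : exists A, (A ^ n.+1 <= N ^ k)%N by exists 0; rewrite exp0n.
  have bd A : (A ^ n.+1 <= N ^ k)%N -> (A <= N ^ k)%N.
    by apply: leq_trans; case: A => // A; rewrite expnS leq_pmulr // expn_gt0.
  case: (ex_maxnP ex bd) => A hA maxA; exists A.
    by rewrite (maxA 1) // exp1n expn_gt0.
  by rewrite hA ltnNge; apply/negP => /maxA; rewrite ltnn.
have [a [b [[j1 aj1] aA ab]]] := dirichlet_linear_form
  (fun j => (v j)%:~R / N%:R ^+ k : R) (ltn0Sn m) A0.
(* The largest coefficient is the unit of width: |a.w| <= 2n |a j0| as soon as |w| <= 2. *)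
have [j0 j0max] : exists j0, forall j, `|a j| <= `|a j0|.
  have [j0 _ h] := @arg_maxP _ _ _ j1 predT (fun j => `|a j|) isT.
  by exists j0 => j; apply: h.
have aj0 : a j0 != 0.
  by rewrite -normr_gt0; apply: lt_le_trans (j0max j1); rewrite normr_gt0.
(* Chosen so that a.d + [beta] is N^{k+1} times the value of the form at the corner of the child
   d. *)
pose beta := \sum_j a j * (N%:Z * v j) + b * N%:Z ^+ k.+1.
have := @slab_count m B (2 * n) a beta j0 aj0.
set S := [set d | _]%SET => cS.
exists (~: S)%SET; split.
  have [le|lt] := leqP (4 * n + 1) B; last first.
    have -> : (B.+1 - (4 * n + 2) = 0)%N by lia.
    by rewrite exp0n.
  have := cardsC S; rewrite card_ffun !card_ord => cSC.
  rewrite -(leq_add2l #|S|) cSC.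
  apply: (@leq_trans (B ^ m * (2 * (2 * n)).+1 + (B - (4 * n + 1)) * B ^ m)).
    rewrite leq_add // expnS.
    have -> : (B.+1 - (4 * n + 2) = B - (4 * n + 1))%N by lia.
    rewrite leq_mul //; case: (m) => // m'.
    by rewrite leq_exp2r // leq_subr.
  by rewrite expnS mulnC -mulnDl; apply: leq_mul => //; lia.
move=> d x; rewrite !inE => dS xc p q q0 qK; rewrite ltNge; apply/negP => qx.
have qR : 0 < q%:R :> R by rewrite ltr0n.
have AR : 0 < A%:R :> R by rewrite ltr0n.
pose u j : R := q%:R * x j 0 - (p j 0)%:~R.
have uq j : N%:R ^+ k.+1 * `|u j| <= q%:R.
  apply: le_trans qx; rewrite ler_pM2l ?exprn_gt0 //.
  by apply: le_trans (le_cV_norm _ j); rewrite !mxE.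
pose th j : R := N%:R ^+ k.+1 * x j 0 - (child N v d j)%:~R.
have thb j : 0 <= th j < 1.
  have /forallP/(_ j)/andP[] := xc => l h.
  by rewrite /th; apply/andP; split; lra.
have xp j : 0 <= N%:R ^+ k * x j 0 - (v j)%:~R <= 1.
  have /forallP/(_ j)/andP[] := in_cube_child (leqnSn B) xc => l h.
  by apply/andP; split; lra.
have on_plane : \sum_j a j * p j 0 + b * q%:Z = 0.
  have Nk : 0 < N%:R ^+ k :> R by rewrite exprn_gt0.
  (* a.p + bq is an integer and equals q (a.x0 + b) plus an error, x0 being the
     corner v / N^k. *)
  have small : `|(\sum_j a j * p j 0 + b * q%:Z)%:~R : R| < 1.
    pose y j : R := x j 0 - (v j)%:~R / N%:R ^+ k.
    have -> : (\sum_j a j * p j 0 + b * q%:Z)%:~R =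
        q%:R * (\sum_j (a j)%:~R * ((v j)%:~R / N%:R ^+ k) + b%:~R) +
        \sum_j (a j)%:~R * (q%:R * y j - u j) :> R.
      rewrite intrD rmorph_sum /= mulrDr mulr_sumr addrAC -big_split /=.
      congr (_ + _); last by rewrite intrM -pmulrn mulrC.
      by apply: eq_bigr => j _; rewrite intrM /u /y; ring.
    have yb : `|\sum_j (a j)%:~R * (q%:R * y j - u j)| <=
        n%:R * (A%:R * (2 * q%:R / N%:R ^+ k)).
      apply: norm_linear_form_le => // j.
      have yj : `|q%:R * y j| <= q%:R / N%:R ^+ k.
        rewrite normrM (gtr0_norm qR) ler_pM2l // /y.
        have -> : x j 0 - (v j)%:~R / N%:R ^+ k =
          (N%:R ^+ k * x j 0 - (v j)%:~R) / N%:R ^+ k by field; lra.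
        have /andP[h1 h2] := xp j; rewrite normrM normfV (gtr0_norm Nk).
        by rewrite ger0_norm // -[leRHS]mul1r ler_pM2r ?invr_gt0.
      have uj : `|u j| <= q%:R / N%:R ^+ k.
        rewrite ler_pdivlMr // mulrC; apply: le_trans (uq j).
        apply: ler_wpM2r => //; rewrite exprS.
        by apply: ler_peMl; [exact: ltW|rewrite (ler_nat R 1)].
      by apply: le_trans (ler_normB _ _) _; lra.
    apply: le_lt_trans (ler_normD _ _) _.
    rewrite normrM (gtr0_norm qR).
    have ANk : A%:R / N%:R ^+ k <= (A%:R ^+ n)^-1 :> R.
      rewrite ler_pdivrMr // mulrC ler_pdivlMr ?exprn_gt0 // -exprS.
      by rewrite -!natrX ler_nat.
    (* The factor 2^n in [denominator_scale] pays for bounding A + 1 by 2A. *)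
    have qA : (q * (2 * n + 1) < A ^ n)%N.
      have : ((2 * n + 1) * 2 ^ n * q < (2 * A) ^ n)%N.
        rewrite -(@ltn_exp2r _ _ n.+1) // expnMn; apply: leq_ltn_trans qK _.
        have -> : (((2 * A) ^ n) ^ n.+1 = ((2 * A) ^ n.+1) ^ n)%N.
          by rewrite -!expnM (mulnC n).
        rewrite expnM ltn_exp2r //.
        by apply: leq_trans A2 _; rewrite leq_exp2r //; lia.
      by rewrite expnMn -mulnA mulnCA ltn_pmul2l ?expn_gt0 // mulnC.
    have : q%:R * (2 * n%:R + 1) * (A%:R ^+ n)^-1 < 1 :> R.
      rewrite ltr_pdivrMr ?exprn_gt0 // mul1r -natrX.
      by have := qA; rewrite -(ltr_nat R) natrM natrD natrM.
    move=> qn; apply: lt_le_trans (ltW qn).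
    have h1 : q%:R * `|\sum_j (a j)%:~R * ((v j)%:~R / N%:R ^+ k) + b%:~R| <
      q%:R * (A%:R ^+ n)^-1 :> R by rewrite ltr_pM2l.
    have h2 : 2 * n%:R * q%:R * (A%:R / N%:R ^+ k) <=
      2 * n%:R * q%:R * (A%:R ^+ n)^-1 :> R by rewrite ler_wpM2l // !mulr_ge0.
    by move: yb; lra.
  have : `|\sum_j a j * p j 0 + b * q%:Z| < 1 by rewrite -(ltr_int R) intr_norm.
  lia.
case/negP: dS.
rewrite -(ler_int R).
(* This is the vector from p/q to the corner of the child, in units of the side of the child.
   Passing through x bounds it by 1 + 1 = 2. *)
pose w j : R := N%:R ^+ k.+1 / q%:R * u j - th j.
have -> : (`|\sum_j a j * (d j : nat)%:Z + beta|%:~R : R) =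
    `|\sum_j (a j)%:~R * w j|.
  rewrite intr_norm; congr (`| _ |).
  have -> : \sum_j (a j)%:~R * w j =
      \sum_j (a j)%:~R * (N%:R * (v j)%:~R + (d j : nat)%:R) -
      N%:R ^+ k.+1 / q%:R * \sum_j (a j)%:~R * (p j 0)%:~R.
    rewrite mulr_sumr -sumrB; apply: eq_bigr => j _.
    by rewrite /w /u /th /child intrD intrM -!pmulrn; field; lra.
  have -> : \sum_j (a j)%:~R * (p j 0)%:~R = - (b%:~R * q%:R) :> R.
    have := congr1 (fun z : int => z%:~R : R) on_plane.
    rewrite intrD rmorph_sum /= intrM -pmulrn => /eqP.
    rewrite addr_eq0 => /eqP <-.
    by apply: eq_bigr => j _; rewrite intrM.
  rewrite /beta addrA -big_split /= intrD rmorph_sum intrM rmorphXn /= -pmulrn.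
  congr (_ + _); last by field; lra.
  apply: eq_bigr => j _; rewrite intrD !intrM -!pmulrn; ring.
apply: le_trans (@norm_linear_form_le _ _ a w `|a j0|%:~R 2 _ _) _.
- by move=> j; rewrite -intr_norm ler_int.
- move=> j; have /andP[h1 h2] := thb j.
  have : `|N%:R ^+ k.+1 / q%:R * u j| <= 1.
    rewrite normrM (gtr0_norm (divr_gt0 _ qR)) ?exprn_gt0 //.
    by rewrite mulrAC ler_pdivrMr // mul1r.
  rewrite /w; move: (th j) h1 h2 (N%:R ^+ k.+1 / q%:R * u j) => y h1 h2 z.
  rewrite ler_norml => /andP[h3 h4].
  by clear - h1 h2 h3 h4; rewrite ler_norml; apply/andP; split; lra.
by rewrite intrM -!pmulrn natrM -/n le_eqVlt; apply/orP; left; apply/eqP; ring.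
Qed.

(** * Avoiding a countable cover *)

Lemma nested_intervals (R : realType) (lo hi : nat -> R) :
  (forall k, lo k <= lo k.+1) -> (forall k, hi k.+1 <= hi k) ->
  (forall k, lo k <= hi k) -> exists x, forall k, lo k <= x <= hi k.
Proof.
move=> /nondecreasing_seqP lo_mono /nonincreasing_seqP hi_mono lohi.
have lo_hi i k : lo i <= hi k.
  apply: (@le_trans _ _ (lo (maxn i k))); first exact/lo_mono/leq_maxl.
  by apply: le_trans (lohi _) _; apply/hi_mono/leq_maxr.
exists (sup (range lo)) => k; apply/andP; split.
  by apply: ub_le_sup; [exists (hi k) => _ [i _ <-]|exists k].
by apply: ge_sup; [exists (lo 0), 0|move=> _ [i _ <-]].
Qed.

Lemma digit_expansion_point (R : realType) n (B : nat) (V : nat -> 'I_n -> int)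
    (dg : nat -> {ffun 'I_n -> 'I_B}) :
  (forall k, V k.+1 = child B.+1 (V k) (dg k)) ->
  exists x : 'cV[R]_n, forall k, in_cube B.+1 k (V k) x.
Proof.
move=> VS; set N : R := B.+1%:R.
have N0 : 0 < N by rewrite ltr0n.
have NX k : 0 < N ^+ k by rewrite exprn_gt0.
have NE k : (N ^+ k)^-1 = N / N ^+ k.+1.
  by rewrite exprS invfM mulrA mulfV ?gt_eqF // mul1r.
have Vstep k j : N * (V k j)%:~R <= (V k.+1 j)%:~R /\
    (V k.+1 j)%:~R + 1 < N * ((V k j)%:~R + 1).
  rewrite VS /child intrD intrM -!pmulrn -/N mulrDr mulr1.
  have : (dg k j : nat)%:R + 1 < N by rewrite natr1 ltr_nat ltnS.
  by have := ler0n R (dg k j); split; lra.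
have /choice[x Hx] : forall j, exists xj : R, forall k,
    (V k j)%:~R / N ^+ k <= xj <= ((V k j)%:~R + 1) / N ^+ k.
  move=> j; apply: nested_intervals => k.
  - by rewrite NE mulrA ler_pM2r ?invr_gt0 // mulrC (Vstep k j).1.
  - rewrite (NE k) mulrA ler_pM2r ?invr_gt0 // [leRHS]mulrC ltW //.
    exact: (Vstep k j).2.
  - by rewrite ler_pM2r ?invr_gt0 // lerDl.
exists (\col_j x j) => k; apply/forallP => j; rewrite mxE.
(* The strict upper bound at level k comes from the closed one at level k + 1, whose right end is
   strictly smaller. *)
have /andP[l _] := Hx j k; have /andP[_ u] := Hx j k.+1.
apply/andP; split; first by rewrite mulrC -ler_pdivrMr.
rewrite mulrC -ltr_pdivlMr //; apply: le_lt_trans u _.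
by rewrite (NE k) mulrA ltr_pM2r ?invr_gt0 // [ltRHS]mulrC (Vstep k j).2.
Qed.

(** This takes the place of a mass distribution argument: every cube has at least M allowed
    children, so a cover of total weight below 1 cannot block all branches. A closed ball of radius
    N^{-k} meets at most 3^n cubes of level k, whence the factor 3^n. *)
Lemma avoid_covering (R : realType) n (B M : nat)
    (G : nat -> ('I_n -> int) -> {set {ffun 'I_n -> 'I_B}})
    (k_ : nat -> nat) (x_ : nat -> 'cV[R]_n) :
  (forall k v, (M <= #|G k v|)%N) -> (0 < M)%N ->
  (\sum_(0 <= i <oo) ((3 ^ n)%:R / M%:R ^+ k_ i : R)%:E < 1)%E ->
  exists (V : nat -> 'I_n -> int) (dg : nat -> {ffun 'I_n -> 'I_B})
    (x : 'cV[R]_n),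
    [/\ forall k, dg k \in G k (V k),
        forall k, V k.+1 = child B.+1 (V k) (dg k),
        forall k, in_cube B.+1 k (V k) x &
        forall i, (B.+1%:R ^+ k_ i)^-1 < `|x - x_ i|].
Proof.
move=> GM M0 sum_lt1; set N := B.+1.
have MR : 0 < M%:R :> R by rewrite ltr0n.
pose y i (e : {ffun 'I_n -> 'I_3}) : 'cV[R]_n :=
  x_ i + (N%:R ^+ k_ i)^-1 *: \col_j ((e j : nat)%:R - 1).
pose w k v i e : R :=
  if (k <= k_ i)%N && in_cube N k v (y i e)
  then M%:R ^+ k / M%:R ^+ k_ i else 0.
have w0 k v i e : 0 <= w k v i e.
  by rewrite /w; case: ifP => // _; rewrite divr_ge0 // exprn_ge0 // ltW.
(* The cover by cubes of side N^{-k_i} around x_i is replaced by one by N-adic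
   cubes, those containing the points y i e. The cost W k v of the part of it
   inside the cube v, rescaled to level k, stays below 1 along a suitable
   branch; a cube of the cover reached by the branch would contribute 1. *)
pose W k v : \bar R := (\sum_(0 <= i <oo) (\sum_e w k v i e)%:E)%E.
have term0 k v i : (0 <= (\sum_e w k v i e)%:E)%E.
  by rewrite lee_fin sumr_ge0.
have W_root : (W 0%N (fun=> 0%R) < 1)%E.
  apply: le_lt_trans sum_lt1; apply: lee_nneseries => // i _.
  have -> : (3 ^ n = #|{ffun 'I_n -> 'I_3}|)%N by rewrite card_ffun !card_ord.
  rewrite lee_fin mulr_natl -sumr_const.
  apply: ler_sum => e _; rewrite /w expr0 mul1r.
  by case: ifP => // _; rewrite invr_ge0 exprn_ge0 // ltW.
(* Children are disjoint, so [y i e] lies in at most one of them, and passing down one level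
   multiplies its weight by M. *)
have child_sum k v i e :
    \sum_(d : {ffun 'I_n -> 'I_B}) w k.+1 (child N v d) i e <= M%:R * w k v i e.
  have [[d0 hd0]|none] := pselect
    (exists d : {ffun 'I_n -> 'I_B}, 0 < w k.+1 (child N v d) i e).
    have : (k < k_ i)%N && in_cube N k.+1 (child N v d0) (y i e).
      by move: hd0; rewrite /w; case: ifP => //; rewrite ltxx.
    move=> /andP[ki in0].
    rewrite (bigD1 d0) //= big1 => [|d dd0].
      rewrite addr0 {1}/w ki in0 /w (ltnW ki) (in_cube_child (leqnSn B) in0) /=.
      by rewrite exprS mulrA.
    rewrite /w; case: ifP => // /andP[_ ind].
    case/eqP: dd0; apply/ffunP => j; apply/val_inj.
    have /andP[] := forallP in0 j; have /andP[] := forallP ind j.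
    rewrite /child !intrD -!pmulrn => h1 h2 h3 h4.
    have : (d j : nat)%:R < (d0 j : nat)%:R + 1 :> R by lra.
    have : (d0 j : nat)%:R < (d j : nat)%:R + 1 :> R by lra.
    rewrite !natr1 !ltr_nat !ltnS /= => ? ?.
    by apply/eqP; rewrite eqn_leq; apply/andP.
  rewrite big1 ?mulr_ge0 // => d _; apply/eqP; rewrite eq_le w0 andbT leNgt.
  by apply/negP => ?; apply: none; exists d.
(* Averaging: if all of the at least M allowed children had cost at least 1, their total would be at
   least M, while it is at most M times [W k v]. *)
have step k v : exists d, (W k v < 1)%E ->
    d \in G k v /\ (W k.+1 (child N v d) < 1)%E.
  have [Wk|] := boolP (W k v < 1)%E; last first.
    have : exists d, d \in G k v.
      by apply/card_gt0P; apply: leq_trans (GM k v).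
    by move=> [d _]; exists d.
  apply: contrapT => H.
  have H1 d : d \in G k v -> (1 <= W k.+1 (child N v d))%E.
    by move=> dG; rewrite leNgt; apply/negP => ?; apply: H; exists d.
  have : (\sum_(d in G k v) W k.+1 (child N v d) <= M%:R%:E * W k v)%E.
    rewrite -nneseries_sum // -nneseriesZl //.
    apply: lee_nneseries => i _; first by move=> _; exact: sume_ge0.
    rewrite sumEFin lee_fin exchange_big /= mulr_sumr.
    apply: ler_sum => e _; apply: le_trans (child_sum k v i e).
    by rewrite [leRHS](bigID (mem (G k v))) /= lerDl sumr_ge0.
  apply/negP; rewrite -ltNge.
  apply: (@lt_le_trans _ _ M%:R%:E).
    by rewrite -[ltRHS]mule1 lte_pmul2l.
  apply: (@le_trans _ _ (\sum_(d in G k v) 1)%E); last exact: lee_sum.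
  by rewrite sumEFin lee_fin sumr_const ler_nat.
have /choice[F HF] : forall kv : nat * ('I_n -> int), exists d,
    (W kv.1 kv.2 < 1)%E ->
    d \in G kv.1 kv.2 /\ (W kv.1.+1 (child N kv.2 d) < 1)%E.
  by move=> [k v]; exact: step.
pose V := nat_rect (fun=> 'I_n -> int) (fun=> 0%R)
  (fun k v => child N v (F (k, v))).
pose dg k := F (k, V k).
have WV k : (W k (V k) < 1)%E by elim: k => [//|k /(HF (k, V k))[]].
have [x xV] : exists x : 'cV[R]_n, forall k, in_cube N k (V k) x.
  exact: (@digit_expansion_point _ _ _ V dg).
exists V, dg, x; split=> //.
  by move=> k; have [] := HF (k, V k) (WV k).
move=> i; rewrite ltNge; apply/negP => xi.
have := WV (k_ i); apply/negP; rewrite -leNgt.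
apply: (@le_trans _ _ (\sum_e w (k_ i) (V (k_ i)) i e)%:E); last first.
  apply: le_trans (@nneseries_lim_ge _ _ xpredT 0 i.+1 _) => //.
  by rewrite big_nat_recr //= leeDr // sume_ge0.
have NX : 0 < N%:R ^+ k_ i :> R by rewrite exprn_gt0 // ltr0n.
(* The cube of the branch is offset from the cube of [x_ i] by -1, 0 or 1 in each coordinate; adding
   1 makes the offset a digit of [e]. *)
have e0P j : exists e : 'I_3, (e : nat)%:Z =
    V (k_ i) j - Num.floor (N%:R ^+ k_ i * x_ i j 0) + 1.
  have : `|N%:R ^+ k_ i * x j 0 - N%:R ^+ k_ i * x_ i j 0| <= 1.
    rewrite -mulrBr normrM (gtr0_norm NX) mulrC -ler_pdivlMr // mul1r.
    by have := le_trans (le_cV_norm (x - x_ i) j) xi; rewrite !mxE.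
  have /andP[] := forallP (xV (k_ i)) j; set z := N%:R ^+ k_ i * x j 0.
  have /andP[] := floor_itv (N%:R ^+ k_ i * x_ i j 0).
  set z' := N%:R ^+ k_ i * x_ i j 0; set f := Num.floor z'.
  rewrite intrD ler_norml => f1 f2 z1 z2 /andP[zz1 zz2].
  have lo : f - 2 < V (k_ i) j by rewrite -(ltr_int R) intrB; lra.
  have hi : V (k_ i) j < f + 2 by rewrite -(ltr_int R) intrD; lra.
  have lt3 : (`|(V (k_ i) j - f + 1)%R|%N < 3)%N.
    by clear - lo hi; lia.
  by exists (Ordinal lt3) => /=; clear - lo hi; lia.
have /choice[e0 He0] := e0P.
rewrite lee_fin (bigD1 (finfun e0)) //= -[leLHS]addr0 lerD ?sumr_ge0 //.
rewrite /w leqnn /=.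
suff -> : in_cube N (k_ i) (V (k_ i)) (y i (finfun e0)).
  by rewrite divff // expf_neq0 // gt_eqF.
apply/forallP => j; rewrite /y !mxE ffunE mulrDr mulrA mulfV ?gt_eqF // mul1r.
have := congr1 (fun z : int => z%:~R : R) (He0 j).
rewrite intrD intrB -pmulrn => ->.
have := floor_itv (N%:R ^+ k_ i * x_ i j 0); rewrite intrD => /andP[f1 f2].
by apply/andP; split; lra.
Qed.

(** Root-free form of |x - p/q| > (c / q^{n+1})^{1/n}. *)
Definition badly_approximable (R : realType) n (c : R) : set 'cV[R]_n :=
  [set x | forall (p : 'cV[int]_n) (q : nat), (0 < q)%N ->
     c < q%:R * `|q%:R *: x - map_mx intr p| ^+ n].

(** Each q is handled at the first level k + 1 where K q^{n+1} <= N^{(k+1)n}. There |qx - p| > q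
    N^{-(k+2)}, while K q^{n+1} > N^{kn}, so q |qx - p|^n > 1 / (K N^{2n}) >= c. *)
Lemma badly_approximable_avoid (R : realType) (m B : nat) (c : R)
    (k_ : nat -> nat) (x_ : nat -> 'cV[R]_m.+1) :
  (4 * m.+1 + 2 < B.+1)%N ->
  c * ((denominator_scale m.+1)%:R * B.+1%:R ^+ (2 * m.+1)) <= 1 ->
  (\sum_(0 <= i <oo) ((3 ^ m.+1)%:R /
     ((B.+1 - (4 * m.+1 + 2)) ^ m.+1)%:R ^+ k_ i : R)%:E < 1)%E ->
  exists2 x, badly_approximable c x &
    forall i, (B.+1%:R ^+ k_ i)^-1 < `|x - x_ i|.
Proof.
set n := m.+1; set N := B.+1; set K := denominator_scale n => NB cK.
have /choice[G0 HG0] : forall kv : nat * ('I_n -> int), _ :=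
  fun kv => @rational_free_children R m B kv.1 kv.2.
move=> /(@avoid_covering R n B _ (fun k v => G0 (k, v)) k_ x_)[||V [dg [x]]].
- by move=> k v; exact: (HG0 (k, v)).1.
- by rewrite expn_gt0 subn_gt0 NB.
move=> [dgG VS xV xU]; exists x => // p q q0.
have N1 : (1 < N)%N by apply: leq_ltn_trans NB; lia.
have [k lk] : exists2 k, (N ^ (k * n) < K * q ^ n.+1)%N &
    (K * q ^ n.+1 <= N ^ (k.+1 * n))%N.
  have ex : exists k, (K * q ^ n.+1 <= N ^ (k * n))%N.
    exists (K * q ^ n.+1)%N; rewrite (mulnC _ n) expnM; apply: ltnW.
    apply: ltn_expl; apply: (@leq_trans (N ^ 1)) => //.
    by rewrite leq_exp2l.
  case: (ex_minnP ex) => -[|k] hk mink.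
    (* The least admissible level is not 0, because K >= 2^{n+1} > 1. *)
    exfalso; move: hk; rewrite mul0n expn0 leqNgt => /negP; apply.
    apply: (@leq_trans K).
      rewrite /K /denominator_scale; apply: (@leq_trans (2 ^ n.+1)).
        by rewrite -[X in (X < _)%N](expn0 2) ltn_exp2l.
      rewrite leq_exp2r // /n; apply: (@leq_trans (2 ^ m.+1)).
        by rewrite -{1}[2%N]expn1 leq_exp2l.
      by rewrite leq_pmull // addn1.
    by rewrite leq_pmulr // expn_gt0 q0.
  by exists k => //; rewrite ltnNge; apply/negP => /mink; rewrite ltnn.
move=> uk.
have H : q%:R < N%:R ^+ k.+2 * `|q%:R *: x - map_mx intr p|.
  apply: ((HG0 (k.+1, V k.+1)).2 (dg k.+1) x) => //.
  by rewrite -VS.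
set z := `|_| in H *.
have NR : 0 < N%:R :> R by rewrite ltr0n.
have qR : 0 < q%:R :> R by rewrite ltr0n.
have KR : 0 < K%:R * N%:R ^+ (2 * n) :> R.
  by rewrite mulr_gt0 ?exprn_gt0 // ltr0n expn_gt0 muln_gt0 expn_gt0 addn1.
have H1 : q%:R ^+ n <= (N%:R ^+ k.+2 * z) ^+ n.
  by rewrite lerXn2r ?nnegrE ?(ltW H) ?(ltW qR) // (le_trans (ltW qR)) ?(ltW H).
rewrite -(ltr_pM2r KR); apply: (le_lt_trans cK).
have Nkn : 0 < (N ^ (k * n))%:R :> R by rewrite ltr0n expn_gt0.
rewrite -(ltr_pM2l Nkn) mulr1.
move: lk; rewrite -(ltr_nat R) => /lt_le_trans; apply.
rewrite natrM [(q ^ _)%:R]natrX exprS.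
apply: (@le_trans _ _ (K%:R * (q%:R * (N%:R ^+ k.+2 * z) ^+ n))).
  by rewrite ler_pM2l ?ler_pM2l // ltr0n expn_gt0 muln_gt0 expn_gt0 addn1.
rewrite exprMn natrX -exprM.
have -> : (k.+2 * n = k * n + 2 * n)%N by lia.
by rewrite exprD le_eqVlt; apply/orP; left; apply/eqP; ring.
Qed.

(** * Nonzero Hausdorff measure from avoidance of covers *)

Lemma diam_ge0 (R : realType) (V : normedModType R) (U : set V) :
  (0 <= diam U)%E.
Proof. by apply: ereal_sup_ubound; left. Qed.

Lemma le_diam (R : realType) (V : normedModType R) (U : set V) x y :
  U x -> U y -> (`|x - y|%:E <= diam U)%E.
Proof.
by move=> Ux Uy; apply: ereal_sup_ubound; right; exists x => //; exists y.
Qed.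

Lemma diam_le (R : realType) (V : normedModType R) (U : set V) (r : R) :
  0 <= r -> (forall x y, U x -> U y -> `|x - y| <= r) -> (diam U <= r%:E)%E.
Proof.
move=> r0 Ur; apply: ge_ereal_sup => _ [->|[x Ux [y Uy <-]]]; first by [].
rewrite lee_fin.
exact: Ur.
Qed.

Lemma diam_pow_ge0 (R : realType) (V : normedModType R) s (U : set V) :
  (0 <= diam_pow s U)%E.
Proof. by rewrite /diam_pow; case: ifP => // _; exact: poweR_ge0. Qed.

Lemma expr_inv_small (R : realType) (M : nat) (eta : R) : (1 < M)%N ->
  0 < eta -> exists k, (M%:R ^+ k)^-1 <= eta.
Proof.
move=> M1 eta0; exists (Num.truncn eta^-1).+1.
have h : eta^-1 <= M%:R ^+ (Num.truncn eta^-1).+1.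
  apply: ltW; apply: lt_le_trans (truncnS_gt _) _.
  by rewrite -natrX ler_nat ltnW // ltn_expl.
rewrite -[leRHS]invrK lef_pV2 ?posrE ?invr_gt0 //.
by rewrite (lt_le_trans _ h) // invr_gt0.
Qed.

(** Take the largest k with diam U <= N^{-k}. Then N^{-k} <= N diam U, and M^{-k} <= N^{-ks} because
    N^s <= M. An empty set or a single point has no largest k; [eta] pays for those. *)
Lemma cube_of_small_set (R : realType) (V : normedModType R) (N M : nat)
    (s : R) (U : set V) (eta : R) :
  (1 < N)%N -> (1 < M)%N -> 0 <= s -> N%:R `^ s <= M%:R -> (diam U <= 1)%E ->
  0 < eta -> exists (k : nat) (x0 : V),
    (forall x, U x -> `|x - x0| <= (N%:R ^+ k)^-1) /\
    (((M%:R ^+ k)^-1)%:E <= (N%:R `^ s)%:E * diam_pow s U + eta%:E)%E.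
Proof.
move=> N1 M1 s0 NM U1 eta0.
have NR : 1 < N%:R :> R by rewrite ltr1n.
have N0 : 0 < N%:R :> R by apply: lt_trans NR.
have Ns0 : (0 <= (N%:R `^ s)%:E)%E by rewrite lee_fin powR_ge0.
have [k0 hk0] := expr_inv_small M1 eta0.
have [U0|/set0P[x0 Ux0]] := eqVneq U set0.
  exists k0, 0; split; first by move=> x; rewrite U0.
  rewrite -[leLHS]add0e; apply: leeD; last by rewrite lee_fin.
  exact: mule_ge0 Ns0 (diam_pow_ge0 _ _).
have [r [r0 r1 dr]] : exists r : R, [/\ 0 <= r, r <= 1 & diam U = r%:E].
  move: U1 (diam_ge0 U); case: (diam U) => [r| |] //.
  by rewrite !lee_fin => ? ?; exists r.
have Ur x : U x -> `|x - x0| <= r.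
  by move=> Ux; rewrite -lee_fin -dr; exact: le_diam.
have [re|rn] := eqVneq r 0.
  exists k0, x0; split.
    by move=> x /Ur /le_trans; apply; rewrite re invr_ge0 exprn_ge0 // ltW.
  rewrite -[leLHS]add0e; apply: leeD; last by rewrite lee_fin.
  exact: mule_ge0 Ns0 (diam_pow_ge0 _ _).
have rp : 0 < r by rewrite lt_neqAle eq_sym rn.
have ex : exists k, r * N%:R ^+ k <= 1 by exists 0%N; rewrite expr0 mulr1.
have bd k : r * N%:R ^+ k <= 1 -> (k <= Num.truncn r^-1)%N.
  move=> h; rewrite -ltnS -(ltr_nat R); apply: le_lt_trans (truncnS_gt _).
  apply: (@le_trans _ _ (N%:R ^+ k)).
    by rewrite -natrX ler_nat ltnW // ltn_expl.
  by rewrite -ler_pdivlMl // mulr1 in h.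
case: (ex_maxnP ex bd) => k hk maxk; exists k, x0; split.
  move=> x /Ur /le_trans; apply.
  by rewrite -[leRHS]mul1r ler_pdivlMr ?exprn_gt0.
rewrite -[leLHS]adde0; apply: leeD; last by rewrite lee_fin ltW.
rewrite /diam_pow ifF; last by apply/negP => /eqP U0; move: Ux0; rewrite U0.
rewrite dr poweR_EFin -EFinM lee_fin -powRM // ?(ltW N0) //.
have Nr : (N%:R ^+ k)^-1 <= N%:R * r.
  rewrite -[leLHS]mul1r ler_pdivrMr ?exprn_gt0 // -mulrA [r * _]mulrC mulrA.
  rewrite -exprS mulrC ltW // ltNge; apply/negP => /maxk; by rewrite ltnn.
apply: (@le_trans _ _ ((N%:R ^+ k)^-1 `^ s)); last first.
  apply: ge0_ler_powR => //; rewrite nnegrE ?invr_ge0 ?exprn_ge0 ?mulr_ge0 //;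
    exact: ltW.
have -> : (N%:R ^+ k)^-1 `^ s = ((N%:R `^ s) ^+ k)^-1.
  have -> : (N%:R ^+ k)^-1 = N%:R `^ (- k%:R) :> R by rewrite powR_invn // ltW.
  by rewrite -powRrM mulrC powRrM powR_invn // powR_ge0.
rewrite lef_pV2 ?posrE ?exprn_gt0 ?powR_gt0 ?ltr0n ?(ltnW M1) //.
  by rewrite lerXn2r ?nnegrE ?powR_ge0.
exact: ltnW.
Qed.

(** A null set would have covers of arbitrarily small cost; rounding their members to balls of
    radius N^{-k} keeps the weight below 1, and the hypothesis then yields a point of A that is not
    covered. *)
Lemma hausdorff_measure_neq0 (R : realType) n (A : set 'cV[R]_n) (N M : nat)
    (s : R) :
  (1 < N)%N -> (1 < M)%N -> 0 <= s -> N%:R `^ s <= M%:R ->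
  (forall (k_ : nat -> nat) (x_ : nat -> 'cV[R]_n),
    (\sum_(0 <= i <oo) ((3 ^ n)%:R / M%:R ^+ k_ i : R)%:E < 1)%E ->
    exists2 x, A x & forall i, (N%:R ^+ k_ i)^-1 < `|x - x_ i|) ->
  hausdorff_measure s A <> 0%E.
Proof.
move=> N1 M1 s0 NM HA mu0.
set T : R := (3 ^ n)%:R * N%:R `^ s.
have T0 : 0 < T by rewrite mulr_gt0 ?powR_gt0 ?ltr0n ?expn_gt0 // ltnW.
have : (hausdorff_content s 1 A < (T^-1 / 2)%:E)%E.
  apply: (@le_lt_trans _ _ 0%E); last by rewrite lte_fin divr_gt0 ?invr_gt0.
  by rewrite -mu0; apply: ereal_sup_ubound; exists 1; rewrite /= ?ltr01.
move=> /ereal_inf_lt[_ [U [AU U1] <-] sumU].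
(* Multiplied by 3^n these rounding errors sum to 1/2; the cost of the cover accounts for less than
   the other 1/2. *)
have e0 i : 0 < (2 * (3 ^ n)%:R * (2 ^ i.+1)%:R)^-1 :> R.
  by rewrite invr_gt0 !mulr_gt0 // ltr0n expn_gt0.
have /choice[k_ /choice[x_ Hkx]] := fun i =>
  cube_of_small_set N1 M1 s0 NM (U1 i) (e0 i).
have [|x Ax xU] := HA k_ x_.
  apply: (@le_lt_trans _ _
    (\sum_(0 <= i <oo)
      (T%:E * diam_pow s (U i) + (2^-1 / (2 ^ i.+1)%:R)%:E))%E).
    apply: lee_nneseries => [i _ _|i _].
      by rewrite lee_fin divr_ge0 // exprn_ge0.
    rewrite EFinM; apply: (@le_trans _ _ ((3 ^ n)%:R%:E *
      ((N%:R `^ s)%:E * diam_pow s (U i) +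
       ((2 * (3 ^ n)%:R * (2 ^ i.+1)%:R)^-1)%:E))%E).
      by apply: lee_wpmul2l; [rewrite lee_fin|exact: (Hkx i).2].
    rewrite ge0_muleDr ?mule_ge0 ?diam_pow_ge0 ?lee_fin ?powR_ge0 ?(ltW (e0 i))
      //.
    rewrite muleA -EFinM -/T; apply: leeD => //; rewrite -EFinM lee_fin.
    rewrite le_eqVlt; apply/orP; left; apply/eqP; field.
    by rewrite !pnatr_eq0 -!lt0n !expn_gt0.
  apply: le_lt_trans (epsilon_trick xpredT _ _) _.
  - by move=> i; rewrite mule_ge0 ?diam_pow_ge0 ?lee_fin ?(ltW T0).
  - by rewrite invr_ge0.
  rewrite nneseriesZl; last by move=> i _; exact: diam_pow_ge0.
  have : (T%:E * \sum_(0 <= i <oo) diam_pow s (U i) < T%:E * (T^-1 / 2)%:E)%E.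
    by rewrite lte_pmul2l.
  rewrite -EFinM mulrA mulfV ?gt_eqF // mul1r => h.
  apply: (@lt_le_trans _ _ (2^-1%:E + 2^-1%:E)%E); first exact: lte_leD.
  by rewrite -EFinD lee_fin; lra.
have [i _ Ux] := AU x Ax.
by have := xU i; apply/negP; rewrite -leNgt; exact: (Hkx i).1.
Qed.

(** * Orbits and Diophantine approximation *)

Lemma flow_lattice_atP (R : realType) n (x : 'cV[R]_n) (s : R) w :
  lattice_act (flow n s) (lattice_at x) w <->
  exists (p : 'cV[int]_n) (q : int),
    w = col_mx (expR s *: (q%:~R *: x - map_mx intr p))
               (const_mx (expR (- (n%:R * s)) * q%:~R)).
Proof.
have act (p : 'cV[int]_n) (q : 'cV[int]_1) :
    flow n s *m (block_mx 1%:M x 0 1%:M *m map_mx intr (col_mx p q)) =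
    col_mx (expR s *: ((q 0 0)%:~R *: x + map_mx intr p))
           (const_mx (expR (- (n%:R * s)) * (q 0 0)%:~R)) :> 'cV[R]_(n + 1).
  rewrite map_col_mx /flow !mul_block_col !mul1mx !mul0mx !add0r !addr0.
  rewrite !mul_scalar_mx; congr col_mx.
    congr (_ *: _); rewrite addrC; congr (_ + _).
    by apply/matrixP => i j; rewrite !mxE big_ord1 !mxE !ord1 mulrC.
  by apply/matrixP => i j; rewrite !ord1 !mxE.
split=> [[_ [z _ <-] <-]|[p [q ->]]].
  exists (- usubmx z), (dsubmx z 0 0).
  by rewrite -{1}(vsubmxK z) act map_mxN opprK.
exists (block_mx 1%:M x 0 1%:M *m map_mx intr (col_mx (- p) (const_mx q))).
  by exists (col_mx (- p) (const_mx q)).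
by rewrite act map_mxN mxE.
Qed.

Lemma flow_lattice_at_unimodular (R : realType) n (x : 'cV[R]_n) (s : R) :
  unimodular_lattice (lattice_act (flow n s) (lattice_at x)).
Proof.
exists (flow n s *m block_mx 1%:M x 0 1%:M).
  rewrite /= det_mulmx /flow !det_ublock !det_scalar !expr1n mulr1 mulr1 expr1.
  by rewrite -expRM_natl -expRD subrr expR0.
apply/seteqP; split=> w.
  move=> [z _ <-]; exists (block_mx 1%:M x 0 1%:M *m map_mx intr z).
    by exists z.
  by rewrite mulmxA.
by move=> [_ [z _ <-] <-]; exists z => //; rewrite mulmxA.
Qed.

Lemma norm_col_mx (R : realType) m n (a : 'cV[R]_m) (b : 'cV[R]_n) :
  `|col_mx a b| = Num.max `|a| `|b|.
Proof.
apply/eqP; rewrite eq_le; apply/andP; split.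
  apply: cV_norm_le; first by rewrite le_max normr_ge0.
  move=> j; case: (splitP j) => i ji.
    have -> : j = lshift n i by apply/val_inj.
    by rewrite col_mxEu le_max le_cV_norm.
  have -> : j = rshift m i by apply/val_inj.
  by rewrite col_mxEd le_max (le_cV_norm b) orbT.
rewrite ge_max; apply/andP; split; apply: cV_norm_le => // j.
  by rewrite -(col_mxEu a b); exact: le_cV_norm.
by rewrite -(col_mxEd a b); exact: le_cV_norm.
Qed.

Lemma norm_const_cV (R : realType) (r : R) : `|const_mx r : 'cV[R]_1| = `|r|.
Proof.
apply/eqP; rewrite eq_le; apply/andP; split.
  by apply: cV_norm_le => // j; rewrite mxE.
by have := le_cV_norm (const_mx r : 'cV[R]_1) 0; rewrite mxE.
Qed.

(** For q nonzero and z = |qx - p|, the product of (e^s z)^n and e^{-ns} |q| does not depend on s,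
    so it bounds the (n+1)-st power of the norm from below. For q = 0 the vector is a nonzero
    integer vector expanded by e^s >= 1. The factor 2 restores the strict inequality lost in passing
    to the infimum. *)
Lemma flow_systole_gt (R : realType) n (x : 'cV[R]_n) (s eps : R) :
  0 <= s -> 0 < eps -> 2 * eps <= 1 ->
  badly_approximable ((2 * eps) ^+ n.+1) x ->
  eps < shortest (lattice_act (flow n s) (lattice_at x)).
Proof.
move=> s0 e0 e1 bx; set L := lattice_act _ _.
have es1 : 1 <= expR s by rewrite -expR0 ler_expR.
apply: (@lt_le_trans _ _ (2 * eps)); first lra.
apply: lb_le_inf.
  have [w [Lw w0]] : exists w, L w /\ w <> 0.
    exists (col_mx (expR s *: (1%:~R *: x - map_mx intr 0))
                   (const_mx (expR (- (n%:R * s)) * 1%:~R))).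
    split; first by apply/flow_lattice_atP; exists 0, 1.
    move=> /(congr1 (@dsubmx _ n 1 1)); rewrite col_mxKd => /matrixP/(_ 0 0).
    by rewrite !mxE mulr1 => /eqP; rewrite gt_eqF ?expR_gt0.
  by exists `|w|, w.
move=> _ [w [/flow_lattice_atP[p [q ->]] w0] <-].
rewrite norm_col_mx norm_const_cV.
rewrite normrZ normrM !(gtr0_norm (expR_gt0 _)) le_max; apply/orP.
set z := `|_ - _|; have z0 : 0 <= z by exact: normr_ge0.
have [q0|q0] := eqVneq q 0.
  left; apply: (le_trans e1).
  have [j pj] : exists j, p j 0 != 0.
    apply: contrapT => H; apply: w0; rewrite q0 scale0r mulr0.
    have -> : p = 0.
      apply/matrixP => i j; rewrite ord1 mxE; apply/eqP/negPn/negP => pi.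
      by apply: H; exists i.
    apply/matrixP => i j; rewrite !mxE; case: splitP => k _;
      by rewrite !mxE ?subr0 ?mulr0.
  rewrite -[leLHS]mul1r; apply: ler_pM => //.
  apply: le_trans (le_cV_norm _ j).
  rewrite q0 scale0r sub0r !mxE normrN -intr_norm.
  by rewrite (ler_int R 1) -gtz0_ge1 normr_gt0.
apply/orP; rewrite -le_max; set m := Num.max _ _.
have m1 : expR s * z <= m by rewrite le_max lexx.
have m2 : expR (- (n%:R * s)) * `|q%:~R| <= m by rewrite le_max lexx orbT.
have m0 : 0 <= m by apply: le_trans m1; rewrite mulr_ge0 ?expR_ge0.
(* Denominators in [badly_approximable] are positive, so the sign of q is moved to p. *)
have := bx ((Num.sg q) *: p) `|q|%N; rewrite absz_gt0 q0 => /(_ isT).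
have qa : (`|q|%N)%:R = `|q%:~R| :> R by rewrite pmulrn abszE intr_norm.
have -> : (`|q|%N)%:R *: x - map_mx intr (Num.sg q *: p) =
    (Num.sg q)%:~R *: (q%:~R *: x - map_mx intr p).
  rewrite scalerBr scalerA -intrM -normrEsg qa -intr_norm; congr (_ - _).
  by apply/matrixP => i j; rewrite !mxE intrM.
rewrite normrZ -intr_norm normr_sg q0 mul1r -/z qa.
have : (expR s * z) ^+ n * (expR (- (n%:R * s)) * `|q%:~R|) <= m ^+ n.+1.
  rewrite exprSr ler_pM ?exprn_ge0 ?mulr_ge0 ?expR_ge0 //.
  by rewrite lerXn2r ?nnegrE ?mulr_ge0 ?expR_ge0.
have -> : (expR s * z) ^+ n * (expR (- (n%:R * s)) * `|q%:~R|) =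
    `|q%:~R| * z ^+ n.
  have : expR (n%:R * s) * expR (- (n%:R * s)) = 1.
    by rewrite -expRD subrr expR0.
  rewrite exprMn -expRM_natl => E.
  transitivity
    ((expR (n%:R * s) * expR (- (n%:R * s))) * (`|q%:~R| * z ^+ n)); first ring.
  by rewrite E mul1r.
move=> h1 h2; have := lt_le_trans h2 h1.
move=> h; apply/ltW; move: h.
by rewrite ltr_pXn2r ?nnegrE // mulr_ge0 // ltW.
Qed.

(** For a violating p/q, the time s with e^{ns} = q / eps brings the last coordinate to exactly eps
    and the others to at most eps in absolute value; s >= 0 because q >= 1 >= eps. *)
Lemma badly_approximable_of_systole (R : realType) n (x : 'cV[R]_n) (eps : R) :
  (0 < n)%N -> 0 < eps -> eps <= 1 ->
  (forall s, 0 <= s ->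
    eps < shortest (lattice_act (flow n s) (lattice_at x))) ->
  badly_approximable (eps ^+ n.+1) x.
Proof.
move=> n0 e0 e1 H p q q0; rewrite ltNge; apply/negP => qz.
set z := `|_| in qz *; have z0 : 0 <= z by exact: normr_ge0.
have nR : 0 < n%:R :> R by rewrite ltr0n.
have qR : 0 < q%:R :> R by rewrite ltr0n.
have qe : 1 <= q%:R / eps.
  by rewrite ler_pdivlMr // mul1r; apply: (le_trans e1); rewrite (ler_nat R 1).
pose s := ln (q%:R / eps) / n%:R.
have ns : n%:R * s = ln (q%:R / eps) by rewrite /s; field; rewrite gt_eqF.
have s0 : 0 <= s by rewrite divr_ge0 // ?ln_ge0 // ltW.
have := H s s0; apply/negP; rewrite -leNgt.
pose w := col_mx (expR s *: (q%:~R *: x - map_mx intr p))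
               (const_mx (expR (- (n%:R * s)) * q%:~R)) : 'cV[R]_(n + 1).
have wE : expR (- (n%:R * s)) * q%:~R = eps.
  rewrite expRN ns lnK ?posrE ?divr_gt0 // -pmulrn; field.
  by rewrite !gt_eqF.
apply: (@le_trans _ _ `|w|).
  apply: ge_inf; first by exists 0 => _ [v _ <-].
  exists w => //; split; first by apply/flow_lattice_atP; exists p, q.
  move=> /(congr1 (@dsubmx _ n 1 1)); rewrite col_mxKd => /matrixP/(_ 0 0).
  by rewrite !mxE wE => /eqP; rewrite gt_eqF.
rewrite norm_col_mx norm_const_cV wE gtr0_norm // ge_max lexx andbT.
rewrite normrZ (gtr0_norm (expR_gt0 _)) -pmulrn -/z.
rewrite -(@ler_pXn2r _ n) // ?nnegrE ?mulr_ge0 ?expR_ge0 ?(ltW e0) //.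
rewrite exprMn -expRM_natl ns lnK ?posrE ?divr_gt0 //.
by rewrite mulrAC ler_pdivrMr // -exprSr.
Qed.

(** * Covering the badly approximable points *)

Definition cube (R : realType) n (y : 'cV[R]_n) (r : R) : set 'cV[R]_n :=
  [set x | forall j, y j 0 <= x j 0 <= y j 0 + r].

Definition subcube_corner (R : realType) n (N : nat) (y : 'cV[R]_n) (r : R)
    (d : {ffun 'I_n -> 'I_N}) : 'cV[R]_n :=
  y + (r / N%:R) *: \col_j (d j : nat)%:R.

Lemma in_subcube (R : realType) n (N : nat) (y : 'cV[R]_n) (r : R) x :
  (0 < N)%N -> 0 < r -> cube y r x ->
  exists d : {ffun 'I_n -> 'I_N}, cube (subcube_corner y r d) (r / N%:R) x.
Proof.
move=> N0 r0 xy; have NR : 0 < N%:R :> R by rewrite ltr0n.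
have /choice[d Hd] : forall j, exists i : 'I_N,
    (i : nat)%:R <= (x j 0 - y j 0) / (r / N%:R) <= (i : nat)%:R + 1.
  move=> j; have /andP[x1 x2] := xy j; set u := (_ / _).
  have u0 : 0 <= u by rewrite divr_ge0 ?divr_ge0 ?subr_ge0 // ltW.
  have uN : u <= N%:R.
    rewrite /u ler_pdivrMr ?divr_gt0 // mulrCA mulfV ?gt_eqF // mulr1; lra.
  have [uN1|uN1] := ltP u N%:R.
    have /truncn_itv/andP[t1 t2] := u0.
    have tN : (Num.truncn u < N)%N by rewrite truncn_lt_nat.
    by exists (Ordinal tN); rewrite /= t1 natr1 ltW.
  (* A point on the far face goes to the last subcube, which is closed. *)
  have tN : (N.-1 < N)%N by rewrite prednK.
  exists (Ordinal tN); rewrite /= natr1 prednK // uN andbT.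
  by apply: le_trans uN1; rewrite ler_nat leq_pred.
exists (finfun d) => j; rewrite !mxE ffunE.
have /andP[] := Hd j.
have rN : 0 < r / N%:R by rewrite divr_gt0.
rewrite ler_pdivlMr // ler_pdivrMr // => h1 h2.
by apply/andP; split; lra.
Qed.

(** For a badly approximable x, Dirichlet's q <= A^n also satisfies q > c A^n, hence |x - p/q| < 1 /
    (c A^{n+1}) <= r/4 by the choice of A. On the subcube containing p/q, q |qx' - p|^n <= q^{n+1}
    (r/N)^n <= (A^{n+1} r / N)^n <= c. *)
Lemma badly_approximable_hole (R : realType) n (N : nat) (c r : R)
    (y : 'cV[R]_n) :
  (4 <= N)%N -> 0 < c -> c <= 1 -> 0 < r -> r <= 1 ->
  (2 ^+ (n + 3) / c) ^+ n <= c * N%:R ^+ n ->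
  exists d : {ffun 'I_n -> 'I_N},
    forall x, cube (subcube_corner y r d) (r / N%:R) x ->
      ~ badly_approximable c x.
Proof.
move=> N4 c0 c1 r0 r1 cN.
have N0 : (0 < N)%N by apply: leq_trans N4.
have NR : 0 < N%:R :> R by rewrite ltr0n.
pose middle : set 'cV[R]_n :=
  [set x | forall j, `|x j 0 - (y j 0 + r / 2)| <= r / 4].
(* If no badly approximable point is near the centre, a central subcube is the
   hole; otherwise a rational near such a point provides it. *)
have [[x xbad xmid]|none] := pselect
    (exists2 x, badly_approximable c x & middle x); last first.
  have yc : cube y r (y + const_mx (r / 2)).
    by move=> j; rewrite !mxE; apply/andP; split; lra.
  have [d Hd] := in_subcube N0 r0 yc.
  exists d => x xd xbad; apply: none; exists x => // j.
  have := xd j; have := Hd j; rewrite !mxE => /andP[a1 a2] /andP[b1 b2].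
  have rN : r / N%:R <= r / 4.
    by rewrite ler_pM2l // lef_pV2 ?posrE // (ler_nat R 4).
  by rewrite ler_norml; apply/andP; split; lra.
have cr : 0 < c * r by rewrite mulr_gt0.
have ex : exists A, 4 <= c * A%:R ^+ n.+1 * r.
  exists (Num.truncn (4 / (c * r))).+1; set A := _.+1.
  rewrite mulrAC -ler_pdivrMl // mulrC; apply: le_trans (ltW (truncnS_gt _)) _.
  by rewrite -/A -natrX ler_nat -[leqLHS]expn1 leq_pexp2l.
(* Since c r <= 1 < 4, the least A is at least 2. Thus A <= 2(A - 1), and minimality bounds A^{n+1}
   r by 2^{n+1} times 4 / c. *)
case: (ex_minnP ex) => -[|[|A']] hA minA.
- by move: hA; rewrite expr0n /= mulr0 mul0r => ?; exfalso; lra.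
- move: hA; rewrite expr1n mulr1 => h; exfalso.
  have : c * r <= 1 by rewrite mulr_ile1 // ltW.
  lra.
have {minA} hA' : c * A'.+1%:R ^+ n.+1 * r < 4.
  by rewrite ltNge; apply/negP => /minA; rewrite ltnn.
set A := A'.+2 in hA *.
have AR : 0 < A%:R :> R by rewrite ltr0n.
have A_le : A%:R ^+ n.+1 * r <= 2 ^+ (n + 3) / c.
  rewrite ler_pdivlMr //.
  have : A%:R ^+ n.+1 <= (2 * A'.+1%:R) ^+ n.+1 :> R.
    rewrite lerXn2r ?nnegrE ?mulr_ge0 ?ler0n // -(natrM _ 2) ler_nat /A; lia.
  rewrite exprMn => h.
  have : A%:R ^+ n.+1 * (c * r) <= 2 ^+ n.+1 * A'.+1%:R ^+ n.+1 * (c * r).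
    by rewrite ler_pM2r.
  have : 2 ^+ n.+1 * (c * A'.+1%:R ^+ n.+1 * r) <= 2 ^+ n.+1 * 4 :> R.
    by rewrite ler_pM2l ?exprn_gt0 // ltW.
  have -> : (2 ^+ (n + 3) = 2 ^+ n.+1 * 4 :> R).
    have -> : (n + 3 = n.+1 + 2)%N by rewrite addSnnS.
    by rewrite exprD; congr (_ * _); ring.
  lra.
have [q [p [q0 qA qxp]]] := dirichlet_simultaneous x (ltn0Sn A'.+1).
rewrite -/A in qA qxp.
have qR : 0 < q%:R :> R by rewrite ltr0n.
have qc : c * A%:R ^+ n < q%:R.
  have := xbad p q q0 => h.
  have : q%:R * `|q%:R *: x - map_mx intr p| ^+ n <= q%:R * (A%:R^-1) ^+ n.
    by rewrite ler_pM2l // lerXn2r ?nnegrE ?invr_ge0 ?ler0n // ltW.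
  by move=> /(lt_le_trans h); rewrite exprVn ltr_pdivlMr ?exprn_gt0.
have zb j : `|x j 0 - (p j 0)%:~R / q%:R| < r / 4.
  have -> : x j 0 - (p j 0)%:~R / q%:R = (q%:R * x j 0 - (p j 0)%:~R) / q%:R.
    by field; rewrite gt_eqF.
  rewrite normrM normfV (gtr0_norm qR) ltr_pdivrMr //.
  have : `|q%:R * x j 0 - (p j 0)%:~R| < A%:R^-1.
    apply: le_lt_trans qxp.
    by have := le_cV_norm (q%:R *: x - map_mx intr p) j; rewrite !mxE.
  move/lt_le_trans; apply.
  rewrite -[leLHS]mul1r ler_pdivrMr //.
  have : (c * A%:R ^+ n) * (r * A%:R) <= q%:R * (r * A%:R).
    by rewrite ler_pM2r ?mulr_gt0 // ltW.
  by move: hA; rewrite exprSr; lra.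
have yz : cube y r (\col_j ((p j 0)%:~R / q%:R)).
  move=> j; rewrite mxE; have := zb j; have := xmid j.
  rewrite ler_norml ltr_norml => /andP[? ?] /andP[? ?].
  by apply/andP; split; lra.
have [d Hd] := in_subcube N0 r0 yz.
exists d => x' x'd /(_ p q q0); apply/negP; rewrite -leNgt.
have dist : `|q%:R *: x' - map_mx intr p| <= q%:R * (r / N%:R).
  apply: cV_norm_le; first by rewrite !mulr_ge0 ?invr_ge0 ?ler0n // ltW.
  move=> j; rewrite !mxE.
  have -> : q%:R * x' j 0 - (p j 0)%:~R = q%:R * (x' j 0 - (p j 0)%:~R / q%:R).
    by field; rewrite gt_eqF.
  rewrite normrM (gtr0_norm qR) ler_pM2l //.
  have := x'd j; have := Hd j; rewrite !mxE => /andP[? ?] /andP[? ?].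
  by rewrite ler_norml; apply/andP; split; lra.
apply: (@le_trans _ _ (q%:R * (q%:R * (r / N%:R)) ^+ n)).
  by rewrite ler_pM2l // lerXn2r ?nnegrE // mulr_ge0 // divr_ge0 // ltW.
apply: (@le_trans _ _ ((A%:R ^+ n.+1 * r) ^+ n / N%:R ^+ n)); last first.
  rewrite ler_pdivrMr ?exprn_gt0 //; apply: le_trans cN.
  have A_ge0 : 0 <= A%:R ^+ n.+1 * r by rewrite mulr_ge0 ?exprn_ge0 ?ltW.
  by rewrite lerXn2r ?nnegrE // (le_trans A_ge0).
have -> : (A%:R ^+ n.+1 * r) ^+ n / N%:R ^+ n =
    (A%:R ^+ n) ^+ n.+1 * (r / N%:R) ^+ n.
  by rewrite exprMn expr_div_n -!exprM (mulnC n) mulrA.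
rewrite exprMn mulrA -exprS ler_pM2r ?exprn_gt0 ?divr_gt0 //.
by rewrite lerXn2r ?nnegrE ?exprn_ge0 ?ler0n // -natrX ler_nat.
Qed.

Lemma badly_approximable_cover (R : realType) n (N : nat) (c : R) k :
  (4 <= N)%N -> 0 < c -> c <= 1 ->
  (2 ^+ (n + 3) / c) ^+ n <= c * N%:R ^+ n ->
  forall (y : 'cV[R]_n) (r : R), 0 < r -> r <= 1 ->
  exists s : seq 'cV[R]_n, (size s <= (N ^ n).-1 ^ k)%N /\
    forall x, cube y r x -> badly_approximable c x ->
      exists2 y', y' \in s & cube y' (r / N%:R ^+ k) x.
Proof.
move=> N4 c0 c1 cN.
have N0 : (0 < N)%N by apply: leq_trans N4.
have NR : 0 < N%:R :> R by rewrite ltr0n.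
elim: k => [|k IH] y r r0 r1.
  exists [:: y]; split=> // x xy _; exists y; first by rewrite mem_head.
  by rewrite expr0 divr1.
have [d0 Hd0] := badly_approximable_hole y N4 c0 c1 r0 r1 cN.
have rN1 : r / N%:R <= 1.
  by rewrite ler_pdivrMr // mul1r (le_trans r1) // (ler_nat R 1).
have /choice[S HS] := fun d : {ffun 'I_n -> 'I_N} =>
  IH (subcube_corner y r d) (r / N%:R) (divr_gt0 r0 NR) rN1.
exists (flatten [seq S d | d <- enum (predC1 d0)]); split.
  rewrite size_flatten /shape -map_comp sumnE big_map.
  apply: (@leq_trans (\sum_(d <- enum (predC1 d0)) (N ^ n).-1 ^ k)).
    by apply: leq_sum => d _; exact: (HS d).1.
  rewrite big_const_seq count_predT -cardE cardC1 card_ffun !card_ord.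
  rewrite iter_addn_0.
  by rewrite mulnC -expnS.
move=> x xy xbad; have [d xd] := in_subcube N0 r0 xy.
have dd0 : d != d0 by apply/eqP => e; apply: (Hd0 x) => //; rewrite -e.
have [y' y's xy'] := (HS d).2 x xd xbad.
exists y'; last by rewrite exprS invfM mulrA.
by apply/flatten_mapP; exists d => //; rewrite mem_enum.
Qed.

Lemma hausdorff_content_ge0 (R : realType) (V : normedModType R) (s delta : R)
    (A : set V) : (0 <= hausdorff_content s delta A)%E.
Proof.
apply: le_ereal_inf_tmp => _ [U _ <-]; apply: nneseries_ge0 => i _ _.
exact: diam_pow_ge0.
Qed.

(** The double family is listed along [pickle]; indices that code no pair receive the empty set,
    which costs 0 even for s = 0. *)
Lemma hausdorff_content_bigcup_le (R : realType) (V : normedModType R)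
    (s delta : R) (A : set V) (U : nat -> nat -> set V) :
  0 <= delta -> A `<=` \bigcup_a \bigcup_b U a b ->
  (forall a b, (diam (U a b) <= delta%:E)%E) ->
  (hausdorff_content s delta A <=
   \sum_(0 <= a <oo) \sum_(0 <= b <oo) diam_pow s (U a b))%E.
Proof.
move=> d0 AU Ud.
pose W i := if pickle_inv i is Some ab then U ab.1 ab.2 else set0.
have pow0 : diam_pow s (set0 : set V) = 0%E by rewrite /diam_pow eqxx.
apply: ge_ereal_inf; exists (\sum_(0 <= i <oo) diam_pow s (W i))%E.
  exists W => //; split.
    move=> x /AU[a _ [b _ Ux]]; exists (pickle (a, b)) => //.
    by rewrite /W (@pickleK_inv _ (a, b)).
  move=> i; rewrite /W; case: pickle_inv => [ab|]; first exact: Ud.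
  by apply: diam_le => // x y [].
rewrite nneseries_esumT; last by move=> i; exact: diam_pow_ge0.
rewrite nneseries_esumT; last first.
  by move=> a; apply: nneseries_ge0 => b _ _; exact: diam_pow_ge0.
under [leRHS]eq_esum => a _.
  rewrite nneseries_esumT; last by move=> b; exact: diam_pow_ge0.
  over.
rewrite esum_esum; last by move=> a b _ _; exact: diam_pow_ge0.
have -> : \esum_(i in [set: nat]) diam_pow s (W i) =
    \esum_(i in range (pickle : nat * nat -> nat)) diam_pow s (W i).
  rewrite [RHS]esum_mkcond; apply: eq_esum => i _.
  case: ifPn => // /negP iN; rewrite /W; case E : pickle_inv => [ab|] //.
  case: iN; rewrite inE; exists ab => //.
  by have := @pickle_invK (nat * nat)%type i; rewrite /ocancel E.
rewrite esum_image; last first.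
  by move=> u v _ _; exact: (pcan_inj pickleK).
have -> : [set: nat] `*`` (fun=> [set: nat]) = [set: nat * nat].
  by apply/seteqP; split.
by apply: le_esum => ab _; rewrite /W pickleK_inv.
Qed.

(** The level k cover of a unit cube costs at most [th] ^ k, which tends to 0. Countably many unit
    cubes with integer corners exhaust the space, and the a-th one is refined until its cost is at
    most eps / 2^{a+1}. *)
Lemma badly_approximable_null (R : realType) n (N : nat) (c s : R) :
  (4 <= N)%N -> 0 < c -> c <= 1 ->
  (2 ^+ (n + 3) / c) ^+ n <= c * N%:R ^+ n ->
  0 <= s -> (N ^ n).-1%:R * N%:R `^ (- s) < 1 ->
  hausdorff_measure s (badly_approximable c : set 'cV[R]_n) = 0%E.
Proof.
move=> N4 c0 c1 cN s0; set th := _ * _ => th1.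
have N0 : (0 < N)%N by apply: leq_trans N4.
have NR : 0 < N%:R :> R by rewrite ltr0n.
have N1 : (1 < N)%N by apply: leq_trans N4.
have th0 : 0 <= th by rewrite mulr_ge0 // powR_ge0.
have diam_cube (y : 'cV[R]_n) r : 0 <= r -> (diam (cube y r) <= r%:E)%E.
  move=> r0; apply: diam_le => // x x' xy x'y; apply: cV_norm_le => // j.
  rewrite !mxE; have /andP[? ?] := xy j; have /andP[? ?] := x'y j.
  by rewrite ler_norml; apply/andP; split; lra.
have diam_pow_cube (y : 'cV[R]_n) r : 0 <= r ->
    (diam_pow s (cube y r) <= (r `^ s)%:E)%E.
  move=> r0; rewrite /diam_pow; case: ifP => _.
    by rewrite lee_fin powR_ge0.
  rewrite -poweR_EFin; apply: gt0_ler_poweR => //; last exact: diam_cube.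
  - by rewrite in_itv /= diam_ge0 leey.
  - by rewrite in_itv /= lee_fin r0 leey.
suff content0 delta : 0 < delta ->
    (hausdorff_content s delta (badly_approximable c : set 'cV[R]_n) <= 0)%E.
  apply/eqP; rewrite eq_le; apply/andP; split.
    by apply: ge_ereal_sup => _ [delta /= d0 <-]; exact: content0.
  apply: le_trans (hausdorff_content_ge0 s 1 _) _.
  by apply: ereal_sup_ubound; exists 1; rewrite /= ?ltr01.
move=> d0; apply/lee_addgt0Pr => eps eps0; rewrite add0e.
have level a : exists k,
    th ^+ k <= eps / (2 ^ a.+1)%:R /\ (N%:R ^+ k)^-1 <= delta.
  have e0 : 0 < eps / (2 ^ a.+1)%:R by rewrite divr_gt0 // ltr0n expn_gt0.
  have [k1 hk1] : exists k1, th ^+ k1 <= eps / (2 ^ a.+1)%:R.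
    have th_lt1 : `|th| < 1 by rewrite ger0_norm.
    have [k1 _ /(_ k1 (leqnn _)) h] :=
      @cvgr0_norm_lt R R _ \oo _ (GRing.exp th) (cvg_expr th_lt1) _ e0.
    exists k1; exact: le_trans (ler_norm _) (ltW h).
  have [k2 hk2] := expr_inv_small N1 d0.
  exists (k1 + k2)%N; rewrite !exprD; split.
    apply: le_trans hk1; rewrite -[leRHS]mulr1 ler_wpM2l ?exprn_ge0 //.
    by rewrite exprn_ile1 // ltW.
  rewrite invfM; apply: le_trans hk2; rewrite -[leRHS]mul1r.
  rewrite ler_wpM2r ?invr_ge0 ?exprn_ge0 ?ler0n // invf_le1 ?exprn_gt0 //.
  by rewrite exprn_ege1 // (ler_nat R 1).
have /choice[k_ Hk] := level.
have N_inv k : 0 < 1 / N%:R ^+ k :> R by rewrite divr_gt0 ?exprn_gt0.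
have /choice[S HS] := fun az : nat * 'cV[int]_n =>
  badly_approximable_cover (k_ az.1) N4 c0 c1 cN (map_mx intr az.2)
    ltr01 (lexx 1).
pose U a b : set 'cV[R]_n :=
  if (unpickle a : option 'cV[int]_n) is Some z then
    if (b < size (S (a, z)))%N then cube (nth 0 (S (a, z)) b) (1 / N%:R ^+ k_ a)
    else set0
  else set0.
have pow0 : diam_pow s (set0 : set 'cV[R]_n) = 0%E by rewrite /diam_pow eqxx.
have diam0 : (diam (set0 : set 'cV[R]_n) <= delta%:E)%E.
  by apply: diam_le => //; exact: ltW.
apply: le_trans (@hausdorff_content_bigcup_le _ _ s delta _ U (ltW d0) _ _) _.
- move=> x xbad.
  pose z : 'cV[int]_n := \col_j Num.floor (x j 0).
  have xz : cube (map_mx intr z) 1 x.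
    move=> j; rewrite !mxE; have /andP[-> /ltW] := floor_itv (x j 0).
    by rewrite intrD.
  have [y' y's xy'] := (HS (pickle z, z)).2 x xz xbad.
  exists (pickle z) => //; exists (index y' (S (pickle z, z))) => //.
  by rewrite /U pickleK index_mem y's nth_index.
- move=> a b; rewrite /U; case: unpickle => [z|//]; case: ifP => // _.
  apply: le_trans (diam_cube _ _ (ltW (N_inv _))) _.
  by rewrite lee_fin div1r; exact: (Hk a).2.
apply: le_trans _ (epsilon_trick0 xpredT (ltW eps0)).
apply: lee_nneseries => [a _ _|a _].
  by apply: nneseries_ge0 => b _ _; exact: diam_pow_ge0.
apply: (@le_trans _ _ (th ^+ k_ a)%:E); last first.
  by rewrite lee_fin; exact: (Hk a).1.
have thk : th ^+ k_ a = ((N ^ n).-1 ^ k_ a)%:R * (1 / N%:R ^+ k_ a) `^ s.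
  rewrite exprMn natrX; congr (_ * _); rewrite div1r.
  have -> : (N%:R ^+ k_ a)^-1 = N%:R `^ (- (k_ a)%:R) :> R.
    by rewrite powR_invn // ltW.
  by rewrite -powRrM mulNr mulrC -mulNr powRrM powR_mulrn // powR_ge0.
have [[z Ez]|E] : (exists z, (unpickle a : option 'cV[int]_n) = Some z) \/
  (unpickle a : option 'cV[int]_n) = None.
- by case: unpickle => [z|]; [left; exists z|right].
- rewrite (nneseries_split _ (size (S (a, z)))); last first.
    by move=> b _; exact: diam_pow_ge0.
  rewrite add0n [X in (_ + X)%E]eseries0 ?adde0; last first.
    by move=> b /= hb _; rewrite /U Ez ltnNge hb /=.
  apply: (@le_trans _ _
    (\sum_(0 <= b < size (S (a, z))) ((1 / N%:R ^+ k_ a) `^ s)%:E)%E).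
    rewrite !big_mkord; apply: lee_sum => b _; rewrite /U Ez ltn_ord.
    exact: diam_pow_cube (ltW (N_inv _)).
  rewrite sumEFin lee_fin sumr_const_nat subn0 thk -[leLHS]mulr_natl.
  by rewrite ler_wpM2r ?powR_ge0 // ler_nat; exact: (HS (a, z)).1.
- rewrite eseries0 ?lee_fin ?exprn_ge0 // => b _ _.
  by rewrite /U E.
Qed.

(** * Dimension estimates *)

Lemma hausdorff_measure_null_subset (R : realType) (V : normedModType R) (s : R)
    (A B : set V) : A `<=` B -> hausdorff_measure s B = 0%E ->
  hausdorff_measure s A = 0%E.
Proof.
move=> AB B0; apply/eqP; rewrite eq_le; apply/andP; split.
  apply: ge_ereal_sup => _ [delta /= d0 <-].
  apply: (@le_trans _ _ (hausdorff_content s delta B)).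
    apply: ereal_inf_le_tmp => _ [U [BU Ud] <-]; exists U => //; split=> //.
    exact: subset_trans AB BU.
  by rewrite -B0; apply: ereal_sup_ubound; exists delta.
apply: le_trans (hausdorff_content_ge0 s 1 A) _.
by apply: ereal_sup_ubound; exists 1; rewrite /= ?ltr01.
Qed.

(** On this range 1 <= (1 - x)(1 + 2x) and 1 + 2x <= e^{2x}. Used to bound the number of children
    below by an exponential. *)
Lemma expRN2_le_onem (R : realType) (x : R) : 0 <= x -> x <= 2^-1 ->
  expR (- (2 * x)) <= 1 - x.
Proof.
move=> x0 x1; rewrite expRN -div1r ler_pdivrMr ?expR_gt0 //.
have := expR_ge1Dx (2 * x); set e := expR _ => he.
apply: (@le_trans _ _ ((1 - x) * (1 + 2 * x))); last first.
  by rewrite ler_wpM2l //; lra.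
by nra.
Qed.

(* If N <= slab_const e^{t/(2n)}, then (2 eps)^{n+1} N^{2n} is at most the
   inverse of denominator_scale n. *)
Definition slab_const (R : realType) n : R :=
  (2 ^+ n.+1 * (denominator_scale n)%:R)^-1.

Lemma slab_const_gt0 (R : realType) n : 0 < slab_const R n.
Proof.
rewrite invr_gt0 mulr_gt0 ?exprn_gt0 // ltr0n /denominator_scale.
by rewrite expn_gt0 muln_gt0 addn1 expn_gt0.
Qed.

Lemma slab_const_le1 (R : realType) n : slab_const R n <= 1.
Proof.
rewrite invf_le1; last by rewrite -invr_gt0; exact: slab_const_gt0.
rewrite -[leLHS]mulr1 ler_pM // ?exprn_ege1 // ?(ler_nat R 1) //.
by rewrite expn_gt0 muln_gt0 addn1 expn_gt0.
Qed.

Definition large_systole_orbits (R : realType) n (eps : R) : set 'cV[R]_n :=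
  [set x | forall s, 0 <= s ->
     ~ short_lattice eps (lattice_act (flow n s) (lattice_at x))].

(** Take N to be the integer part of h E and x = (4n + 2)/N, so M = N^n (1 - x)^n and N^s <= M
    follows from 2n x <= (n - s) ln N. With N >= h E / 2 and ln N >= t / (4n) this gives the
    constant in the statement. The threshold on t ensures N >= 8n + 4, that is x <= 1/2. *)
Lemma systole_dim_ge (R : realType) (m : nat) (t : R) : let n := m.+1 in
  2 * n%:R * (16 * n%:R + 8) / slab_const R n <= t ->
  ((n%:R - (16 * n%:R ^+ 2 * (4 * n%:R + 2) / slab_const R n) /
      (t * expR (t / (2 * n%:R))))%:E <=
   hausdorff_dim (@large_systole_orbits R n (expR (- (t / (n%:R + 1))))))%E.
Proof.
move=> n; set h := slab_const R n => ht.
have n1 : 1 <= n%:R :> R by rewrite (ler_nat R 1).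
have h0 : 0 < h := slab_const_gt0 R n.
have h1 : h <= 1 := slab_const_le1 R n.
have hK : 2 ^+ n.+1 * (denominator_scale n)%:R * h = 1.
  by rewrite /h /slab_const mulfV // -invr_eq0 gt_eqF.
clearbody h.
have hV : 1 <= h^-1 by rewrite -[1]invr1 lef_pV2 ?posrE.
have t_big : 2 * n%:R * (16 * n%:R + 8) <= t.
  apply: le_trans ht; rewrite -[leLHS]mulr1 ler_wpM2l //; nra.
have t0 : 0 < t by nra.
set E := expR (t / (2 * n%:R)).
have n0 : 0 < n%:R :> R by lra.
have E_ge : (16 * n%:R + 8) / h <= E.
  apply: le_trans (expR_ge1Dx _).
  have : (16 * n%:R + 8) / h <= t / (2 * n%:R).
    rewrite ler_pdivlMr ?mulr_gt0 //; apply: le_trans ht.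
    by rewrite le_eqVlt; apply/orP; left; apply/eqP; ring.
  lra.
set Y := h * E.
have Y_ge : 16 * n%:R + 8 <= Y by rewrite /Y (mulrC h) -ler_pdivrMr.
have Y0 : 0 <= Y by lra.
have /truncn_itv/andP[NY YN] := Y0.
case EN : (Num.truncn Y) NY YN => [|B] NY YN; first by exfalso; lra.
rewrite -natr1 in YN; set N : R := B.+1%:R in NY YN.
have N_half : Y / 2 <= N by lra.
have NB : (4 * n + 2 < B.+1)%N.
  by rewrite -(ltr_nat R) natrD natrM -/N; lra.
set M := ((B.+1 - (4 * n + 2)) ^ n)%N.
have M1 : (1 < M)%N.
  rewrite /M; apply: (@leq_trans (B.+1 - (4 * n + 2))); last first.
    by rewrite -{1}[X in (X <= _)%N]expn1 leq_pexp2l // subn_gt0.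
  have NB2 : (8 * n + 4 <= B.+1)%N by rewrite -(ler_nat R) natrD natrM -/N; lra.
  by clear - NB2; lia.
set eps := expR (- (t / (n%:R + 1))).
have eps0 : 0 < eps by exact: expR_gt0.
have eps_half : 2 * eps <= 1.
  rewrite /eps expRN -[leRHS](@mulfV _ (expR (t / (n%:R + 1))))
    ?gt_eqF ?expR_gt0 //.
  rewrite ler_pM2r ?invr_gt0 ?expR_gt0 //; apply: le_trans (expR_ge1Dx _).
  have : 1 <= t / (n%:R + 1) by rewrite ler_pdivlMr; nra.
  lra.
have epsX : eps ^+ n.+1 = expR (- t).
  rewrite /eps -expRM_natl -natr1; congr expR; field; lra.
(* N^{2n} <= h^{2n} e^t <= h e^t since h <= 1, and h is the inverse of the remaining constants. *)
have cK : (2 * eps) ^+ n.+1 * ((denominator_scale n)%:R * N ^+ (2 * n)) <= 1.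
  have NX : N ^+ (2 * n) <= h * expR t.
    apply: (@le_trans _ _ (Y ^+ (2 * n))).
      by rewrite lerXn2r ?nnegrE ?ler0n.
    rewrite /Y exprMn -expRM_natl natrM.
    have -> : 2 * n%:R * (t / (2 * n%:R)) = t by field; lra.
    rewrite ler_pM2r ?expR_gt0 //.
    have -> : (2 * n = (2 * m + 1).+1)%N.
      by rewrite addn1 -[RHS]/(2 + 2 * m)%N -mulnS.
    by rewrite exprS -[leRHS]mulr1 ler_pM2l // exprn_ile1 // ltW.
  rewrite exprMn epsX.
  have P0 : 0 <= 2 ^+ n.+1 * expR (- t) * (denominator_scale n)%:R :> R.
    by rewrite mulr_ge0 ?ler0n // mulr_ge0 ?expR_ge0.
  rewrite mulrA; apply: le_trans (ler_wpM2l P0 NX) _.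
  have -> : 2 ^+ n.+1 * expR (- t) * (denominator_scale n)%:R * (h * expR t) =
    (2 ^+ n.+1 * (denominator_scale n)%:R * h) * (expR (- t) * expR t) by ring.
  by rewrite -expRD addNr expR0 mulr1 hK.
apply: le_ereal_inf_tmp => _ [s [/= s0 mu_s] <-]; rewrite lee_fin leNgt.
apply/negP => s_lt; move: mu_s.
have N0 : 0 < N by rewrite ltr0n.
(* Half of the exponent t/(2n) of E absorbs the factor h/2. *)
have lnN : t / (4 * n%:R) <= ln N.
  rewrite -ler_expR lnK ?posrE //; apply: le_trans N_half.
  rewrite /Y; set e := expR _.
  have -> : E = e * e.
    by rewrite /E /e -expRD; congr expR; field; lra.
  have he : 2 / h <= e.
    apply: le_trans (expR_ge1Dx _).
    have : 2 / h <= t / (4 * n%:R).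
      rewrite ler_pdivlMr ?mulr_gt0 //; apply: le_trans ht.
      have -> : 2 / h * (4 * n%:R) = (8 * n%:R) / h by ring.
      rewrite ler_pM2r ?invr_gt0 //.
      have : 0 <= n%:R * n%:R :> R by rewrite mulr_ge0.
      lra.
    by move=> /le_trans; apply; rewrite lerDr.
  have e0 : 0 < e by exact: expR_gt0.
  by move: he; rewrite ler_pdivrMr // => he; nra.
apply: (@hausdorff_measure_neq0 R n _ B.+1 M s) => //.
- by apply: leq_ltn_trans NB; rewrite addn2.
- rewrite -/N /powR gt_eqF //.
  pose x := (4 * n%:R + 2) / N.
  have x0 : 0 <= x by rewrite divr_ge0 //; lra.
  have xh : x <= 2^-1 by rewrite ler_pdivrMr //; lra.
  have -> : M%:R = N ^+ n * (1 - x) ^+ n.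
    rewrite /M natrX -exprMn; congr (_ ^+ _).
    rewrite natrB ?(ltnW NB) // natrD natrM -/N /x; field; lra.
  apply: (@le_trans _ _ (N ^+ n * expR (- (2 * x)) ^+ n)); last first.
    rewrite ler_pM2l ?exprn_gt0 // lerXn2r ?nnegrE ?expR_ge0 //; last first.
      exact: expRN2_le_onem.
    lra.
  rewrite -{2}(@lnK _ N) ?posrE // -!expRM_natl -expRD ler_expR.
  have key : 2 * n%:R * x <= (n%:R - s) * ln N.
    have s_lt' :
        (16 * n%:R ^+ 2 * (4 * n%:R + 2) / h) / (t * E) <= n%:R - s by lra.
    have E0 : 0 < E by exact: expR_gt0.
    apply: le_trans (ler_pM _ _ s_lt' lnN);
      rewrite ?divr_ge0 ?mulr_ge0 ?exprn_ge0 //; try lra.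
    have xE : x <= (4 * n%:R + 2) * (2 / (h * E)).
      rewrite /x ler_pM2l; last lra.
      rewrite -[leRHS]invrK lef_pV2 ?posrE ?invr_gt0 ?divr_gt0 ?mulr_gt0 //.
      by rewrite invf_div.
    have -> : 16 * n%:R ^+ 2 * (4 * n%:R + 2) / h / (t * E) * (t / (4 * n%:R)) =
        2 * n%:R * ((4 * n%:R + 2) * (2 / (h * E))).
      by field; rewrite !gt_eqF.
    by rewrite ler_pM2l // mulr_gt0.
  lra.
move=> k_ x_ /(@badly_approximable_avoid R m B _ k_ x_ NB cK)[x bx xU].
exists x => // s' s'0 [_]; apply/negP; rewrite -ltNge.
exact: flow_systole_gt.
Qed.

(** From 1 - u <= e^{-u} with u = N^{-n}, the measure vanishes at s once (n - s) ln N < N^{-n}. Here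
    ln N <= (n + 6) t and N^n <= 2^{(n+4)n} E; n + 7 in place of n + 6 makes the inequality
    strict. *)
Lemma systole_dim_le (R : realType) (n : nat) (t : R) :
  (0 < n)%N -> 1 <= t ->
  (hausdorff_dim (@large_systole_orbits R n (expR (- (t / (n%:R + 1))))) <=
   (n%:R - ((2 ^+ ((n + 4) * n))^-1 / (n%:R + 7)) /
      (t * expR ((n%:R + 1) * t)))%:E)%E.
Proof.
move=> n_gt0 t1.
have n1 : 1 <= n%:R :> R by rewrite (ler_nat R 1).
have n0 : 0 < n%:R :> R by lra.
set E := expR ((n%:R + 1) * t).
have E1 : 1 <= E by rewrite -expR0 ler_expR; nra.
set eps := expR (- (t / (n%:R + 1))).
have eps0 : 0 < eps by exact: expR_gt0.
have eps1 : eps <= 1.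
  by rewrite /eps -expR0 ler_expR oppr_le0 divr_ge0 //; lra.
have epsX : eps ^+ n.+1 = expR (- t).
  rewrite /eps -expRM_natl -natr1; congr expR; field; lra.
set ku := (_^-1 / _).
have P0 : 0 < 2 ^+ ((n + 4) * n) :> R by rewrite exprn_gt0.
have P1 : 1 <= 2 ^+ ((n + 4) * n) :> R by rewrite exprn_ege1 // (ler_nat R 1).
have ku0 : 0 < ku by rewrite divr_gt0 ?invr_gt0 //; lra.
have ku1 : ku * (n%:R + 7) = (2 ^+ ((n + 4) * n))^-1.
  by rewrite /ku divfK // gt_eqF; lra.
have tE : 0 < t * E by rewrite mulr_gt0; lra.
(* X solves (2^{n+3} / c)^n = c X^n for c = e^{-t}, the condition on N for a hole to exist. *)
set X : R := 2 ^+ (n + 3) * expR (t * (n%:R + 1) / n%:R).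
have X1 : 4 <= X.
  have e1 : 1 <= expR (t * (n%:R + 1) / n%:R).
    by rewrite -expR0 ler_expR divr_ge0 ?mulr_ge0 //; lra.
  have p1 : 4 <= 2 ^+ (n + 3) :> R.
    by rewrite -(natrX _ 2) (ler_nat R 4) (@leq_pexp2l 2 2) // addnC.
  by rewrite /X -[leLHS]mulr1 ler_pM.
have /truncn_itv/andP[NX XN] : 0 <= X by lra.
set N := (Num.truncn X).+1 in XN.
have N2X : N%:R <= 2 * X by rewrite /N -natr1; lra.
have N0 : 0 < N%:R :> R by rewrite ltr0n.
apply: ereal_inf_lbound; set s := n%:R - _; exists s => //.
have s0 : 0 <= s.
  have : ku / (t * E) <= 1.
    rewrite ler_pdivrMr // mul1r.
    have : ku <= 1.
      rewrite /ku ler_pdivrMr; last lra.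
      have : (2 ^+ ((n + 4) * n))^-1 <= 1 :> R by rewrite invf_le1.
      lra.
    nra.
  rewrite /s; lra.
split=> //; apply: (@hausdorff_measure_null_subset _ _ _ _
  (badly_approximable (eps ^+ n.+1))).
  move=> x /= xs; apply: badly_approximable_of_systole => // s' s'0.
  rewrite ltNge; apply/negP => short; apply: (xs s' s'0).
  by split; [exact: flow_lattice_at_unimodular|].
rewrite epsX; apply: (@badly_approximable_null _ _ N).
- by rewrite -(ler_nat R); apply: le_trans (ltW XN).
- exact: expR_gt0.
- by rewrite -expR0 ler_expR; lra.
- apply: (@le_trans _ _ (expR (- t) * X ^+ n)); last first.
    by rewrite ler_pM2l ?expR_gt0 // lerXn2r ?nnegrE ?ler0n ?(ltW XN) //; lra.
  rewrite expRN invrK /X !exprMn mulrCA ler_pM2l ?exprn_gt0 //.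
  rewrite -!expRM_natl -expRN -expRD ler_expR le_eqVlt; apply/orP; left.
  by apply/eqP; field; rewrite gt_eqF.
- exact: s0.
have X2 : 2 * X = 2 ^+ (n + 4) * expR (t * (n%:R + 1) / n%:R).
  by rewrite /X mulrA -exprS -(addnS n 3).
have X_pow : (2 * X) ^+ n = 2 ^+ ((n + 4) * n) * E.
  rewrite X2 exprMn -exprM -expRM_natl; congr (_ * expR _).
  by field; rewrite gt_eqF.
(* N <= 2X, where 2 <= e and (n+1)/n <= 2 give ln(2X) <= n + 4 + 2t, and t >= 1. *)
have lnN : ln N%:R <= (n%:R + 6) * t.
  rewrite -ler_expR lnK ?posrE //; apply: (le_trans N2X); rewrite X2.
  apply: (@le_trans _ _ (expR 1 ^+ (n + 4) * expR (2 * t))).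
    apply: ler_pM; rewrite ?exprn_ge0 ?expR_ge0 //.
      rewrite lerXn2r ?nnegrE ?expR_ge0 //.
      by have := expR_ge1Dx (1 : R); lra.
    by rewrite ler_expR ler_pdivrMr //; nra.
  rewrite -expRM_natl mulr1 -expRD ler_expR natrD; nra.
have Nn0 : 0 < N%:R ^+ n :> R by rewrite exprn_gt0.
have key : ku / (t * E) * ln N%:R < (N%:R ^+ n)^-1.
  apply: (@lt_le_trans _ _ ((2 * X) ^+ n)^-1); last first.
    rewrite lef_pV2 ?posrE // ?exprn_gt0 //; last lra.
    by rewrite lerXn2r ?nnegrE ?ler0n //; lra.
  rewrite X_pow [ltRHS]invfM -ku1.
  apply: (@le_lt_trans _ _ (ku / (t * E) * ((n%:R + 6) * t))).
    by rewrite ler_wpM2l // divr_ge0 // ltW.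
  have E0 : 0 < E by lra.
  have -> : ku / (t * E) * ((n%:R + 6) * t) = ku * (n%:R + 6) / E.
    by field; rewrite !gt_eqF //; lra.
  by rewrite ltr_pM2r ?invr_gt0 // ltr_pM2l //; lra.
have -> : (N ^ n).-1%:R = N%:R ^+ n * (1 - (N%:R ^+ n)^-1) :> R.
  rewrite mulrBr mulr1 mulfV ?gt_eqF // -subn1 natrB ?expn_gt0 //.
  by rewrite natrX.
apply: (@le_lt_trans _ _ (N%:R ^+ n * expR (- (N%:R ^+ n)^-1) * N%:R `^ (- s))).
  by rewrite ler_pM2r ?powR_gt0 // ler_pM2l // expR_ge1Dx.
rewrite /powR gt_eqF // -{1}(@lnK _ N%:R) ?posrE // -expRM_natl -!expRD.
by rewrite -[ltRHS]expR0 ltr_expR /s; lra.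
Qed.

Unset Implicit Arguments.

Theorem corollary1p3 (R : realType) (n : nat) (hn : (1 <= n)%N) :
  exists kl ku t0 : R, [/\ 0 < kl, 0 < ku, 0 < t0 &
    forall t : R, t0 <= t ->
      let D := hausdorff_dim
        [set x : 'cV[R]_n | forall s : R, 0 <= s ->
           ~ short_lattice (expR (- (t / (n%:R + 1))))
               (lattice_act (flow n s) (lattice_at x))] in
      ((n%:R - kl / (t * expR (t / (2 * n%:R))))%:E <= D)%E /\
      (D <= (n%:R - ku / (t * expR ((n%:R + 1) * t)))%:E)%E].
Proof.
have n1 : 1 <= n%:R :> R by rewrite (ler_nat R 1).
have h0 := slab_const_gt0 R n; have h1 := slab_const_le1 R n.
have hV : 1 <= (slab_const R n)^-1 by rewrite -[1]invr1 lef_pV2 ?posrE.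
(* The threshold of the lower bound thus also serves for the upper bound, which asks for t >= 1. *)
have t0_ge1 : 1 <= 2 * n%:R * (16 * n%:R + 8) / slab_const R n.
  by rewrite -[leLHS]mulr1 ler_pM //; nra.
exists (16 * n%:R ^+ 2 * (4 * n%:R + 2) / slab_const R n),
  ((2 ^+ ((n + 4) * n))^-1 / (n%:R + 7)),
  (2 * n%:R * (16 * n%:R + 8) / slab_const R n); split.
- by rewrite divr_gt0 // mulr_gt0 ?mulr_gt0 ?exprn_gt0 //; lra.
- by rewrite divr_gt0 ?invr_gt0 ?exprn_gt0 //; lra.
- lra.
move=> t ht D; split.
  case: n hn {n1 h0 h1 hV t0_ge1} @D ht => [|m] // _ D ht.
  exact: systole_dim_ge.
by apply: systole_dim_le => //; exact: le_trans ht.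
Qed.
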